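(* Let $n\ge 1$. If $\phi: Sp(2n,\mathbb{Z})\to Sp(2n,\mathbb{Z})$ is an automorphism, then $R(\phi)=\infty$.
   Context: $Sp(2n,\mathbb{Z})$ is the (proper) symplectic group over the integers: the group of $2n\times 2n$ integer matrices $(a_{i,j})$ such that for all $1\le l<j\le 2n$ the sum $\sum_{i=1}^{n}(a_{2i-1,l}a_{2i,j}-a_{2i-1,j}a_{2i,l})$ equals $1$ if $(l,j)=(2k-1,2k)$ for some $k$, and equals $0$ otherwise. For an automorphism $\phi$ of a group $G$, the Reidemeister classes (twisted $\phi$-conjugacy classes) are the equivalence classes of the relation $x\sim gx\phi(g^{-1})$, $g\in G$. The Reidemeister number $R(\phi)$ is the number of Reidemeister classes of $\phi$ ($\infty$ if there are infinitely many). *)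

(* Defs.v *)
From HB Require Import structures.
From mathcomp Require Import all_boot all_order all_algebra.
From mathcomp Require Import finmap mathcomp_extra boolp classical_sets functions.
From mathcomp Require Import cardinality constructive_ereal.

Set Implicit Arguments.
Unset Strict Implicit.
Unset Printing Implicit Defensive.

Import GRing.Theory.

Section Reidemeister.
Local Open Scope group_scope.
Local Open Scope classical_set_scope.
Variables (G : groupType) (phi : G -> G).

Definition twisted_conj (x y : G) : Prop :=
  exists g : G, y = g * x * phi g^-1.

Definition reidemeister_class (x : G) : set G := [set y | twisted_conj x y].

Definition reidemeister_classes : set (set G) := range reidemeister_class.

Definition reidemeister_number : \bar nat :=
  if pselect (finite_set reidemeister_classes)
  then (#|` fset_set reidemeister_classes|)%fset%:E%E else +oo%E.

End Reidemeister.

Section Symplectic.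
Local Open Scope ring_scope.
Variable n : nat.

Fact idx1_subproof (i : 'I_n) : (2 * i < 2 * n)%N.
Proof. by rewrite ltn_pmul2l. Qed.

Fact idx2_subproof (i : 'I_n) : (2 * i + 1 < 2 * n)%N.
Proof. by rewrite !mul2n addn1 ltn_Sdouble. Qed.

(* The 1-based indices 2i-1 and 2i (1 <= i <= n) become, with i, rows and
   columns numbered from 0, the indices 2i and 2i+1 (0 <= i < n). *)
Definition idx1 (i : 'I_n) : 'I_(2 * n) := Ordinal (idx1_subproof i).
Definition idx2 (i : 'I_n) : 'I_(2 * n) := Ordinal (idx2_subproof i).

Definition symplectic_form (A : 'M[int]_(2 * n)) (l j : 'I_(2 * n)) : int :=
  \sum_(i < n) (A (idx1 i) l * A (idx2 i) j - A (idx1 i) j * A (idx2 i) l).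

Definition symplectic_pair (l j : 'I_(2 * n)) : bool :=
  [exists k : 'I_n, (l == idx1 k) && (j == idx2 k)].

Definition symplectic (A : 'M[int]_(2 * n)) : bool :=
  [forall l : 'I_(2 * n), forall j : 'I_(2 * n), (l < j)%N ==>
     (symplectic_form A l j == if symplectic_pair l j then 1 else 0)].

(* Sp n is Sp(2n, Z): the parameter is half the size of the matrices. *)
Definition Sp : Type := {A : 'M[int]_(2 * n) | symplectic A}.
HB.instance Definition _ := [isSub for (@sval _ _ : Sp -> 'M[int]_(2 * n))].
HB.instance Definition _ := [Choice of Sp by <:].

(* The matrix of the standard symplectic form; the defining equations say that
   A^T J A = J, which is what makes Sp closed under product and inverse. *)
Definition Jmx : 'M[int]_(2 * n) :=
  \matrix_(l, j) ((symplectic_pair l j)%:R - (symplectic_pair j l)%:R).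

Lemma symplectic_pair_ltn l j : symplectic_pair l j -> (l < j)%N.
Proof. by case/existsP=> k /andP[/eqP-> /eqP->] /=; rewrite addn1. Qed.

Lemma idx1_inj : injective idx1.
Proof. by move=> i k /(congr1 val)/= /eqP; rewrite eqn_pmul2l // => /eqP/val_inj. Qed.

Lemma idx2_inj : injective idx2.
Proof.
by move=> i k /(congr1 val)/= /eqP; rewrite eqn_add2r eqn_pmul2l // => /eqP/val_inj.
Qed.

Lemma JmxE l j : Jmx l j =
  \sum_(i < n) ((l == idx1 i)%:R * (j == idx2 i)%:R
                - (j == idx1 i)%:R * (l == idx2 i)%:R).
Proof.
have E a b : (symplectic_pair a b)%:R =
    \sum_(i < n) (a == idx1 i)%:R * (b == idx2 i)%:R :> int.
  rewrite /symplectic_pair; case: existsP => [[k /andP[/eqP-> /eqP->]]|h].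
    rewrite (bigD1 k) //= !eqxx mulr1 big1 ?addr0 // => i ik.
    by rewrite (inj_eq idx1_inj) eq_sym (negPf ik) mul0r.
  rewrite big1 // => i _; case: (a =P _) => [ea|_]; rewrite ?mul0r //.
  case: (b =P _) => [eb|_]; rewrite ?mulr0 //.
  by case: h; exists i; rewrite ea eb !eqxx.
by rewrite mxE !E sumrB.
Qed.

Lemma symplectic_formE A l j : symplectic_form A l j = (A^T *m Jmx *m A) l j.
Proof.
have pick (k : 'I_(2 * n)) (f : 'I_(2 * n) -> int) :
    \sum_a f a * (a == k)%:R = f k.
  rewrite (bigD1 k) //= eqxx mulr1 big1 ?addr0 // => a /negPf->.
  by rewrite mulr0.
rewrite mxE /symplectic_form.
transitivity (\sum_(b < 2 * n) \sum_(i < n)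
    (A (idx1 i) l * (b == idx2 i)%:R - (b == idx1 i)%:R * A (idx2 i) l) * A b j).
  rewrite exchange_big /=; apply: eq_bigr => i _.
  rewrite -(pick (idx2 i) (fun b => A (idx1 i) l * A b j)).
  rewrite -(pick (idx1 i) (fun b => A b j * A (idx2 i) l)) -sumrB.
  apply: eq_bigr => b _; rewrite mulrBl -!mulrA; congr (_ * _ - _).
    by rewrite mulrC.
  by rewrite [LHS]mulrC [A (idx2 i) l * _]mulrC -mulrA.
apply: eq_bigr => b _; rewrite -mulr_suml; congr (_ * _); rewrite mxE.
transitivity (\sum_(a < 2 * n) \sum_(i < n) A a l *
    ((a == idx1 i)%:R * (b == idx2 i)%:R - (b == idx1 i)%:R * (a == idx2 i)%:R)).
  rewrite exchange_big /=; apply: eq_bigr => i _.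
  rewrite -[A (idx1 i) l](pick _ (fun a => A a l)).
  rewrite -[A (idx2 i) l](pick _ (fun a => A a l)).
  rewrite mulr_suml mulr_sumr -sumrB; apply: eq_bigr => a _.
  rewrite mulrBr; congr (_ - _); first by rewrite mulrA.
  by rewrite mulrA [_ * A a l]mulrC -mulrA.
by apply: eq_bigr => a _; rewrite mxE JmxE mulr_sumr.
Qed.

Lemma symplecticP A : reflect (A^T *m Jmx *m A = Jmx) (symplectic A).
Proof.
have anti B l j : symplectic_form B l j = - symplectic_form B j l.
  by rewrite /symplectic_form -sumrN; apply: eq_bigr => i _; rewrite opprB.
apply: (iffP idP) => [/forallP h|h].
  have lt (l j : 'I_(2 * n)) : (l < j)%N -> (A^T *m Jmx *m A) l j = Jmx l j.
    move=> lj; have /forallP/(_ j) := h l; rewrite lj -symplectic_formE mxE /=.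
    move/eqP->; have /negPf-> : ~~ symplectic_pair j l.
      by apply/negP => /symplectic_pair_ltn; rewrite ltnNge (ltnW lj).
    by rewrite subr0; case: symplectic_pair.
  have aJ l j : Jmx l j = - Jmx j l by rewrite !mxE opprB.
  apply/matrixP => l j; case: (ltngtP l j) => [/lt //|jl|/val_inj ->].
    by rewrite -symplectic_formE anti symplectic_formE lt // -aJ.
  rewrite -symplectic_formE [RHS]mxE subrr /symplectic_form big1 // => i _.
  by rewrite subrr.
apply/forallP => l; apply/forallP => j; apply/implyP => lj.
rewrite symplectic_formE h mxE.
have /negPf-> : ~~ symplectic_pair j l.
  by apply/negP => /symplectic_pair_ltn; rewrite ltnNge (ltnW lj).
by rewrite subr0; case: symplectic_pair.
Qed.

Lemma idxP (l : 'I_(2 * n)) : (exists k, l = idx1 k) \/ (exists k, l = idx2 k).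
Proof.
have h : (l./2 < n)%N by rewrite ltn_half_double -mul2n.
have := odd_double_half l; rewrite -mul2n => E.
case o: (odd l) E => E; [right|left]; exists (Ordinal h); apply/val_inj => /=.
  by rewrite addnC; apply: esym.
by apply: esym.
Qed.

Lemma Jmx_unit : Jmx \in unitmx.
Proof.
have n12 i k : (idx1 i == idx2 k) = false.
  by apply/eqP => /(congr1 (fun x : 'I__ => odd x)) /=; rewrite oddD !oddM.
have n21 i k : (idx2 i == idx1 k) = false by rewrite eq_sym n12.
have sum1 (k : 'I_n) (f : 'I_n -> int) : \sum_i (k == i)%:R * f i = f k.
  rewrite (bigD1 k) //= eqxx mul1r big1 ?addr0 // => a ak.
  by rewrite eq_sym (negPf ak) mul0r.
have pick (k : 'I_(2 * n)) (f : 'I_(2 * n) -> int) :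
    \sum_a (a == k)%:R * f a = f k.
  rewrite (bigD1 k) //= eqxx mul1r big1 ?addr0 // => a /negPf->.
  by rewrite mul0r.
have J1 k j : Jmx (idx1 k) j = (j == idx2 k)%:R.
  rewrite JmxE -(sum1 k (fun i => (j == idx2 i)%:R)); apply: eq_bigr => i _.
  by rewrite n12 mulr0 subr0 (inj_eq idx1_inj).
have J2 k j : Jmx (idx2 k) j = - (j == idx1 k)%:R.
  rewrite JmxE -(sum1 k (fun i => (j == idx1 i)%:R)) -sumrN.
  apply: eq_bigr => i _.
  by rewrite n21 mul0r sub0r (inj_eq idx2_inj) mulrC.
have JJ : Jmx *m (- Jmx) = 1%:M.
  rewrite mulmxN; apply/matrixP => l j; rewrite !mxE.
  case: (idxP l) => [[k ->]|[k ->]].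
    under eq_bigr do rewrite J1.
    by rewrite pick J2 opprK eq_sym.
  under eq_bigr do rewrite J2 mulNr.
  by rewrite sumrN opprK pick J1 eq_sym.
by have [] := mulmx1_unit JJ.
Qed.

Lemma symplectic1 : symplectic 1%:M.
Proof. by apply/symplecticP; rewrite trmx1 mul1mx mulmx1. Qed.

Lemma symplecticM A B : symplectic A -> symplectic B -> symplectic (A *m B).
Proof.
move=> /symplecticP hA /symplecticP hB; apply/symplecticP.
by rewrite trmx_mul !mulmxA -[_ *m A^T *m Jmx]mulmxA -[_ *m _ *m A]mulmxA hA.
Qed.

Lemma symplectic_unit A : symplectic A -> A \in unitmx.
Proof.
move=> /symplecticP hA; have := Jmx_unit.
by rewrite -{1}hA unitmx_mul => /andP[].
Qed.

Lemma symplecticV A : symplectic A -> symplectic (invmx A).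
Proof.
move=> sA; have uA := symplectic_unit sA; apply/symplecticP.
have /symplecticP hA := sA.
rewrite -{1}hA !mulmxA -trmx_mul mulmxV // trmx1 mul1mx.
by rewrite -mulmxA mulmxV // mulmx1.
Qed.

Definition Sp_one : Sp := exist _ 1%:M symplectic1.
Definition Sp_mul (x y : Sp) : Sp :=
  exist _ (sval x *m sval y) (symplecticM (svalP x) (svalP y)).
Definition Sp_inv (x : Sp) : Sp :=
  exist _ (invmx (sval x)) (symplecticV (svalP x)).

Lemma Sp_mulA : associative Sp_mul.
Proof. by move=> x y z; apply/val_inj; rewrite /= mulmxA. Qed.
Lemma Sp_mul1 : left_id Sp_one Sp_mul.
Proof. by move=> x; apply/val_inj; rewrite /= mul1mx. Qed.
Lemma Sp_mulr1 : right_id Sp_one Sp_mul.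
Proof. by move=> x; apply/val_inj; rewrite /= mulmx1. Qed.
Lemma Sp_mulV : left_inverse Sp_one Sp_inv Sp_mul.
Proof.
by move=> x; apply/val_inj; rewrite /= mulVmx // symplectic_unit // (svalP x).
Qed.
Lemma Sp_mulrV : right_inverse Sp_one Sp_inv Sp_mul.
Proof.
by move=> x; apply/val_inj; rewrite /= mulmxV // symplectic_unit // (svalP x).
Qed.

HB.instance Definition _ :=
  isGroup.Build Sp Sp_mulA Sp_mul1 Sp_mulr1 Sp_mulV Sp_mulrV.

End Symplectic.

(* Main.v *)
Require Import Defs.
From HB Require Import structures.
From mathcomp Require Import all_boot all_order all_algebra.
From mathcomp Require Import boolp classical_sets.
From mathcomp Require Import cardinality constructive_ereal.
From mathcomp Require Import ring lra zify.

(** An automorphism [phi] of Sp(2n, Z) is, up to signs, the conjugation by a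
    rational matrix [P] ([automorphism_rigidity]). Then [y = g x phi(g^-1)] gives
    [y P = g (x P) g^-1] up to sign, so [tr (x P) ^ 2] only depends on the
    twisted class of [x] ([twisted_trace_invariant]). Along [x = y t^k], for a
    transvection [t] and a suitable [y], this trace is a non-constant affine
    function of [k], hence there are infinitely many classes.

    To find [P], regard [phi] as a faithful representation [Phi] on Q^2n. The
    sign changes of the [n] hyperbolic planes form a group (Z/2)^n of commuting
    isometries. Its image splits Q^2n into orthogonal isotypic components, of
    rank at least two because the form is alternating, and at least [n] of them
    are needed for faithfulness; so these are exactly [n] planes. The [n]
    copies of SL_2(Z) preserve them and commute with each other; as two subsets
    of a 2 x 2 matrix algebra that commute with each other are not both
    non-commutative, each copy is concentrated on one plane and acts by signs
    on the others ([pair_plane]).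

    A transvection acts on its plane by a matrix of trace 2 or -2. For [n >= 2]
    this holds because its square is a commutator of two elements that commute
    with it ([trace_cond_gt1]). For [n = 1] one reduces modulo the trace: the
    image of [phi] becomes, modulo signs, a quotient of S_3, which is impossible
    for SL_2(Z/m) with [m > 2], and the traces 0, 1 and -1 would give elements of
    finite order ([trace_sq4]). Hence the square of [Phi t] is a
    transvection [x |-> x + 2 k omega(w, x) w], up to the scaling of [w] and [k].

    The transvections along [e_i], [f_i] and [e_0 + e_j] commute or braid
    according to a tree. The commutation and braid relations determine the
    pairings of the vectors [w] up to sign, and on a tree the signs can be
    adjusted ([frame_exists]); this gives [P]. The signs of [Phi] itself are
    controlled by a commutant computation ([commutant]), and the passage from
    these transvections to all of Sp(2n, Z) uses the transitivity of the group
    that they generate on the images of the basis vectors, which is the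
    Euclidean algorithm ([reach_primitive]). *)

Set Implicit Arguments.
Unset Strict Implicit.
Unset Printing Implicit Defensive.

Import Order.TTheory GRing.Theory Num.Theory.
Local Open Scope ring_scope.

(** * Alternating forms and rank-one maps *)

Section Form.
Variables (R : numDomainType) (m : nat) (J : 'M[R]_m).
Implicit Types (u v x y : 'cV[R]_m) (A : 'M[R]_m).

(** The bilinear form of matrix [J]. *)
Definition omega u v : R := (u^T *m J *m v) 0 0.

(** The rank-one map [x |-> omega v x *: u]; for [J] alternating,
    [1 + tens v v] is the transvection along [v]. *)
Definition tens u v : 'M[R]_m := u *m v^T *m J.

Lemma mx11_omega u v : u^T *m J *m v = (omega u v)%:M.
Proof. exact: mx11_scalar. Qed.

Lemma tensMv u v x : tens u v *m x = omega v x *: u.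
Proof. by rewrite /tens -!mulmxA (mulmxA v^T) mx11_omega mul_mx_scalar. Qed.

Lemma mul_tens A u v : A *m tens u v = tens (A *m u) v.
Proof. by rewrite /tens !mulmxA. Qed.

Lemma tensZl a u v : tens (a *: u) v = a *: tens u v.
Proof. by rewrite /tens -!scalemxAl. Qed.

Lemma tensZr a u v : tens u (a *: v) = a *: tens u v.
Proof. by rewrite /tens linearZ /= -scalemxAr -scalemxAl. Qed.

Lemma tensNl u v : tens (- u) v = - tens u v.
Proof. by rewrite /tens !mulNmx. Qed.

Lemma tensNr u v : tens u (- v) = - tens u v.
Proof. by rewrite /tens linearN /= mulmxN mulNmx. Qed.

Lemma tensDl u u' v : tens (u + u') v = tens u v + tens u' v.
Proof. by rewrite /tens !mulmxDl. Qed.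

Lemma tensDr u v v' : tens u (v + v') = tens u v + tens u v'.
Proof. by rewrite /tens linearD /= mulmxDr mulmxDl. Qed.

Lemma tensM u v x y : tens u v *m tens x y = omega v x *: tens u y.
Proof. by rewrite mul_tens tensMv tensZl. Qed.

Lemma omegaDl u u' v : omega (u + u') v = omega u v + omega u' v.
Proof. by rewrite /omega linearD /= !mulmxDl mxE. Qed.

Lemma omegaDr u v v' : omega u (v + v') = omega u v + omega u v'.
Proof. by rewrite /omega mulmxDr mxE. Qed.

Lemma omegaZl a u v : omega (a *: u) v = a * omega u v.
Proof. by rewrite /omega linearZ /= -!scalemxAl mxE. Qed.

Lemma omegaZr a u v : omega u (a *: v) = a * omega u v.
Proof. by rewrite /omega -!scalemxAr mxE. Qed.

Lemma omegaNl u v : omega (- u) v = - omega u v.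
Proof. by rewrite -scaleN1r omegaZl mulN1r. Qed.

Lemma omegaNr u v : omega u (- v) = - omega u v.
Proof. by rewrite -scaleN1r omegaZr mulN1r. Qed.

Lemma omega0r u : omega u 0 = 0.
Proof. by rewrite /omega mulmx0 mxE. Qed.

Lemma mxtrace_tens u v : \tr (tens u v) = omega v u.
Proof.
by rewrite /tens -mulmxA mxtrace_mulC mx11_omega mxtrace_scalar mulr1n.
Qed.

(** An isometry conjugates [tens u v] to the tensor of the images. *)
Lemma isometry_tens A u v : A^T *m J *m A = J ->
  A *m tens u v = tens (A *m u) (A *m v) *m A.
Proof. by move=> hA; rewrite /tens trmx_mul -{1}hA !mulmxA. Qed.

Hypothesis JT : J^T = - J.

Lemma omegaC u v : omega u v = - omega v u.
Proof.
rewrite /omega; have -> : u^T *m J *m v = (v^T *m J^T *m u)^T.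
  by rewrite !trmx_mul !trmxK mulmxA.
by rewrite JT mulmxN mulNmx !mxE.
Qed.

Lemma omega_id u : omega u u = 0.
Proof.
have /eqP := omegaC u u.
by rewrite -subr_eq0 opprK -mulr2n mulrn_eq0 /= => /eqP.
Qed.

Lemma tens_id2 u : tens u u *m tens u u = 0.
Proof. by rewrite tensM omega_id scale0r. Qed.

(** Transvections preserve the form. *)
Lemma transv_isometry v :
  (1%:M + tens v v)^T *m J *m (1%:M + tens v v) = J.
Proof.
have e : (tens v v)^T *m J = - (J *m tens v v).
  by rewrite /tens !trmx_mul trmxK JT !mulNmx !mulmxA.
rewrite [(_ + _)^T]raddfD /= [_^T]trmx1 mulmxDl mul1mx e mulmxDr mulmx1 mulmxBl.
by rewrite -[J *m _ *m _]mulmxA tens_id2 mulmx0 subr0 subrK.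
Qed.

(** The rank-one maps of two non-orthogonal vectors do not commute. *)
Lemma tens_comm_omega u v : omega u v != 0 ->
  tens u u *m tens v v != tens v v *m tens u u.
Proof.
move=> h; apply/eqP; rewrite !tensM (omegaC v u) => /(congr1 (mulmx^~ v)).
rewrite -!scalemxAl !tensMv omega_id scale0r scaler0 => /eqP.
rewrite eq_sym !scalemx_eq0 oppr_eq0 (negPf h) /= => /eqP v0.
by rewrite v0 omega0r eqxx in h.
Qed.

(** If [omega u v = 1] or [-1], the transvections along [u] and [v] satisfy
    the braid relation. *)
Lemma transv_braid u v : omega u v ^+ 2 = 1 ->
  (1%:M + tens u u) *m (1%:M + tens v v) *m (1%:M + tens u u) =
  (1%:M + tens v v) *m (1%:M + tens u u) *m (1%:M + tens v v).
Proof.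
move=> h.
have aba x y : omega x y ^+ 2 = 1 ->
    tens x x *m tens y y *m tens x x = - tens x x.
  move=> hxy; rewrite tensM -scalemxAl tensM scalerA (omegaC y x) mulrN.
  by rewrite -expr2 hxy scaleN1r.
move: (aba u v h) (tens_id2 u) (tens_id2 v) => h1 h2 h3.
have h4 : tens v v *m tens u u *m tens v v = - tens v v.
  by apply: aba; rewrite omegaC sqrrN.
rewrite !mulmxDl !mulmxDr !mul1mx !mulmx1 !mulmxDl !mul1mx h1 h2 h3 h4.
move: (tens _ _ *m tens _ _) (tens _ _ *m tens _ _) (1%:M) => C D I.
by apply/matrixP => i j; rewrite !mxE; ring.
Qed.

End Form.

(** * Transvections in the integral symplectic group *)

Section Transvections.
Variable n : nat.
Local Notation J := (Jmx n).
Local Notation om := (omega J).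
Local Notation tn := (tens J).
Implicit Types (u v : 'cV[int]_(2 * n)) (g h : Sp n) (i j : 'I_n).

Lemma JmxT : J^T = - J.
Proof. by apply/matrixP => l j; rewrite !mxE opprB. Qed.

(** The standard symplectic basis [e_i], [f_i]. *)
Definition ev i : 'cV[int]_(2 * n) := delta_mx (idx1 i) 0.
Definition fv i : 'cV[int]_(2 * n) := delta_mx (idx2 i) 0.

Lemma idx12 i j : (idx1 i == idx2 j) = false.
Proof. by apply/eqP => /(congr1 (fun x : 'I__ => odd x)) /=; rewrite oddD !oddM. Qed.

Lemma idx21 i j : (idx2 i == idx1 j) = false.
Proof. by rewrite eq_sym idx12. Qed.

Lemma pair12 i j : symplectic_pair (idx1 i) (idx2 j) = (i == j).
Proof.
apply/existsP/eqP => [[k]|<-]; last by exists i; rewrite !eqxx.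
by rewrite (inj_eq (@idx1_inj n)) (inj_eq (@idx2_inj n)) => /andP[/eqP-> /eqP->].
Qed.

Lemma pair11 i j : symplectic_pair (idx1 i) (idx1 j) = false.
Proof. by apply/existsP => -[k]; rewrite idx12 andbF. Qed.

Lemma pair2x i l : symplectic_pair (idx2 i) l = false.
Proof. by apply/existsP => -[k]; rewrite idx21. Qed.

Lemma omega_delta (l j : 'I_(2 * n)) :
  om (delta_mx l 0) (delta_mx j 0) = J l j.
Proof. by rewrite /omega trmx_delta -rowE -colE !mxE. Qed.

Lemma omega_ee i j : om (ev i) (ev j) = 0.
Proof. by rewrite omega_delta mxE !pair11 subrr. Qed.

Lemma omega_ff i j : om (fv i) (fv j) = 0.
Proof. by rewrite omega_delta mxE !pair2x subrr. Qed.

Lemma omega_ef i j : om (ev i) (fv j) = (i == j)%:R.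
Proof. by rewrite omega_delta mxE pair12 pair2x subr0. Qed.

Lemma omega_fe i j : om (fv i) (ev j) = - (i == j)%:R.
Proof. by rewrite omega_delta mxE pair12 pair2x sub0r eq_sym. Qed.

Definition omegaE := (omega_ee, omega_ff, omega_ef, omega_fe).

(** Coordinates are given by pairing with the dual basis vector. *)
Lemma coord_e i v : v (idx1 i) 0 = - om (fv i) v.
Proof.
rewrite /omega trmx_delta -rowE; apply/eqP; rewrite -eqr_oppLR; apply/eqP.
rewrite mxE (bigD1 (idx1 i)) //= big1 => [|l li].
  by rewrite !mxE pair12 pair2x eqxx sub0r mulN1r addr0.
rewrite !mxE pair2x sub0r; case: (idxP l) li => -[k ->].
  by rewrite (inj_eq (@idx1_inj n)) pair12 => /negPf->; rewrite oppr0 mul0r.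
by rewrite pair2x oppr0 mul0r.
Qed.

Lemma coord_f i v : v (idx2 i) 0 = om (ev i) v.
Proof.
rewrite /omega trmx_delta -rowE mxE (bigD1 (idx2 i)) //= big1 => [|l li].
  by rewrite !mxE pair12 pair2x eqxx subr0 mul1r.
rewrite !mxE; case: (idxP l) li => -[k ->]; first by rewrite !pair11 subrr mul0r.
rewrite (inj_eq (@idx2_inj n)) pair12 pair2x subr0 eq_sym => /negPf->.
by rewrite mul0r.
Qed.

Fact tv_subproof v : symplectic (1%:M + tn v v).
Proof. by apply/symplecticP; apply: transv_isometry JmxT _. Qed.

(** The transvection [x |-> x + omega v x *: v], as an element of Sp. *)
Definition tv v : Sp n :=
  exist (fun A : 'M[int]_(2 * n) => symplectic A : Prop) _ (tv_subproof v).

Lemma val_tv v : val (tv v) = 1%:M + tn v v.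
Proof. by []. Qed.

Lemma Sp_isometry g : (val g)^T *m J *m val g = J.
Proof. by apply/symplecticP; apply: (svalP g). Qed.

Lemma val_SpM g h : val (g * h)%g = val g *m val h.
Proof. by []. Qed.

Lemma val_Sp1 : val (1%g : Sp n) = 1%:M.
Proof. by []. Qed.

Lemma mul_SpVK g (A : 'M_(2 * n, 1)) : val g^-1%g *m (val g *m A) = A.
Proof. by rewrite mulmxA -val_SpM mulVg mul1mx. Qed.

Lemma val_SpVM g : val g^-1%g *m val g = 1%:M.
Proof. by rewrite -val_SpM mulVg. Qed.

Lemma val_SpMV g : val g *m val g^-1%g = 1%:M.
Proof. by rewrite -val_SpM mulgV. Qed.

Lemma tvN v : tv (- v) = tv v.
Proof. by apply: val_inj; rewrite !val_tv tensNl tensNr opprK. Qed.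

Lemma tv_conj g v : (g * tv v * g^-1)%g = tv (val g *m v).
Proof.
apply: val_inj; rewrite !val_SpM !val_tv mulmxDr mulmx1 isometry_tens ?Sp_isometry //.
by rewrite mulmxDl -mulmxA !val_SpMV [_ *m 1%:M]mulmx1.
Qed.

Lemma val_expM (M : 'M[int]_(2 * n)) g :
  M *m M = 0 -> val g = 1%:M + M -> val g^-1%g = 1%:M - M.
Proof.
move=> M2 hg; have hM : val g *m (1%:M - M) = 1%:M.
  by rewrite hg mulmxDl mul1mx mulmxBr mulmx1 M2 subr0 subrK.
transitivity (val g^-1%g *m (val g *m (1%:M - M))); first by rewrite hM mulmx1.
by rewrite mulmxA val_SpVM mul1mx.
Qed.

Lemma tv_comm u v : om u v = 0 -> (tv u * tv v = tv v * tv u)%g.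
Proof.
move=> h; have h' : om v u = 0 by rewrite (omegaC JmxT) h oppr0.
apply: val_inj; rewrite !val_SpM !val_tv !mulmxDl !mulmxDr !mul1mx !mulmx1 !tensM.
by rewrite h h' !scale0r !addr0 -!addrA [X in _ + X]addrC.
Qed.

Lemma tv_ncomm u v : om u v != 0 -> (tv u * tv v)%g != (tv v * tv u)%g.
Proof.
move=> h; apply: contra (tens_comm_omega JmxT h) => /eqP/(congr1 val).
rewrite !val_SpM !val_tv !mulmxDl !mulmxDr !mul1mx !mulmx1 -!addrA => /addrI.
by rewrite addrCA => /addrI/addrI ->.
Qed.

Lemma tv_braid u v : om u v ^+ 2 = 1 ->
  (tv u * tv v * tv u = tv v * tv u * tv v)%g.
Proof. by move=> h; apply: val_inj; apply: transv_braid JmxT _ _ h. Qed.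

(** The short-root element [x |-> x + omega v x *: u + omega u x *: v]. *)
Definition xv u v : Sp n := (tv (u + v) * (tv u)^-1 * (tv v)^-1)%g.

Lemma tens_sym2 u v : om u v = 0 -> (tn u v + tn v u) *m (tn u v + tn v u) = 0.
Proof.
move=> h; have h' : om v u = 0 by rewrite (omegaC JmxT) h oppr0.
by rewrite !mulmxDl !mulmxDr !tensM h h' !(omega_id JmxT) !scale0r !addr0.
Qed.

Lemma val_xv u v : om u v = 0 -> val (xv u v) = 1%:M + (tn u v + tn v u).
Proof.
move=> h; have h' : om v u = 0 by rewrite (omegaC JmxT) h oppr0.
rewrite !val_SpM (@val_expM (tn u u)) ?(@val_expM (tn v v)) ?(tens_id2 JmxT) //=.
rewrite -mulmxA !mulmxDl !mulmxDr !mul1mx !mulmx1 !mulmxN !mulNmx !tensM.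
rewrite !(omegaDl, omegaDr) h h' !(omega_id JmxT) !addr0 !scale0r !oppr0 !addr0.
rewrite ?mulmx0 ?subr0 tensDl !tensDr; apply/matrixP => i j; rewrite !mxE.
ring.
Qed.

Lemma mul_xv u v x : om u v = 0 ->
  val (xv u v) *m x = x + om v x *: u + om u x *: v.
Proof. by move=> h; rewrite val_xv // !mulmxDl mul1mx !tensMv addrA. Qed.

Lemma mul_tv v x : val (tv v) *m x = x + om v x *: v.
Proof. by rewrite val_tv mulmxDl mul1mx tensMv. Qed.

End Transvections.

(** * Transitivity on primitive vectors *)

Section Transitivity.
Variables (n : nat) (i0 : 'I_n) (K : Sp n -> Prop).
Local Notation J := (Jmx n).
Local Notation om := (omega J).
Local Notation tn := (tens J).
Implicit Types (u v : 'cV[int]_(2 * n)) (g h : Sp n) (i j : 'I_n) (s : bool).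

Hypothesis K1 : K 1%g.
Hypothesis KM : forall g h, K g -> K h -> K (g * h)%g.
Hypothesis KV : forall g, K g -> K g^-1%g.
Hypothesis Ke : forall i, K (tv (ev i)).
Hypothesis Kf : forall i, K (tv (fv i)).
Hypothesis Kc : forall i, i != i0 -> K (tv (ev i0 + ev i)).

(** The basis vectors, indexed by a plane and a boolean: [bv false i] is
    [ev i] and [bv true i] is [fv i]. *)
Definition bidx s i : 'I_(2 * n) := if s then idx2 i else idx1 i.
Definition bv s i : 'cV[int]_(2 * n) := if s then fv i else ev i.

Lemma bidx_inj s s' i i' : bidx s i = bidx s' i' -> s = s' /\ i = i'.
Proof.
case: s s' => -[] /eqP; rewrite ?idx12 ?idx21 //= => /eqP.
  by move/(@idx2_inj n).
by move/(@idx1_inj n).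
Qed.

Lemma bvE s i : bv s i = delta_mx (bidx s i) 0.
Proof. by case: s. Qed.

Lemma omega_bv_abs s i v : `|om (bv (~~ s) i) v| = `|v (bidx s i) 0|.
Proof. by case: s; rewrite /= ?coord_e ?coord_f ?normrN. Qed.

Lemma omega_bv_eq0 s i v : (om (bv (~~ s) i) v == 0) = (v (bidx s i) 0 == 0).
Proof. by rewrite -normr_eq0 omega_bv_abs normr_eq0. Qed.

(** [1 + M] is the matrix of an element of [K]. *)
Definition Kx (M : 'M[int]_(2 * n)) := exists2 g, K g & val g = 1%:M + M.
(** The short-root element of [u] and [v] belongs to [K]. *)
Definition Kxs u v := Kx (tn u v + tn v u).

Lemma KxN M : M *m M = 0 -> Kx M -> Kx (- M).
Proof. by move=> M2 [g Kg hg]; exists g^-1%g; [exact: KV | exact: val_expM]. Qed.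

Lemma Kx_tv v : K (tv v) -> Kx (tn v v).
Proof. by move=> h; exists (tv v). Qed.

Lemma KxsC u v : Kxs u v -> Kxs v u.
Proof. by rewrite /Kxs addrC. Qed.

Lemma KxsJ g u v : K g -> Kxs u v -> Kxs (val g *m u) (val g *m v).
Proof.
move=> Kg [h Kh hh]; exists (g * h * g^-1)%g; first by apply: KM (KV _) => //; apply: KM.
rewrite !val_SpM hh mulmxDr mulmxDl [val g *m 1%:M]mulmx1 val_SpMV mulmxDr.
rewrite !isometry_tens ?Sp_isometry // -mulmxDl -mulmxA val_SpMV.
by rewrite [X in _ + X = _]mulmx1.
Qed.

Lemma KxsN u v : om u v = 0 -> Kxs (- u) v -> Kxs u v.
Proof.
move=> h; rewrite /Kxs tensNl tensNr -opprD => k; rewrite -[_ + _]opprK.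
by apply: KxN => //; rewrite mulmxN mulNmx opprK tens_sym2.
Qed.

(** The rotation by a right angle in the [i]-th plane; it is locked so that
    unification does not take it for an explicit product. *)
Definition rot i : Sp n := locked (tv (ev i) * tv (fv i) * tv (ev i))%g.

Lemma rotE i : rot i = (tv (ev i) * tv (fv i) * tv (ev i))%g.
Proof. by rewrite /rot -lock. Qed.

Lemma Krot i : K (rot i).
Proof. by rewrite rotE; apply: KM => //; apply: KM. Qed.

Lemma rot_ev i : val (rot i) *m ev i = - fv i.
Proof.
rewrite rotE !val_SpM -!mulmxA !mul_tv !(omegaDr, omegaZr, omegaNr, omegaE) eqxx.
by apply/matrixP => a b; rewrite !mxE /=; ring.
Qed.

Lemma rot_fv i : val (rot i) *m fv i = ev i.
Proof.
rewrite rotE !val_SpM -!mulmxA !mul_tv !(omegaDr, omegaZr, omegaNr, omegaE) eqxx.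
by apply/matrixP => a b; rewrite !mxE /=; ring.
Qed.

Lemma rot_fix i v : om (ev i) v = 0 -> om (fv i) v = 0 -> val (rot i) *m v = v.
Proof.
move=> he hf; rewrite rotE !val_SpM -!mulmxA !mul_tv !(omegaDr, omegaZr) he hf.
by apply/matrixP => a b; rewrite !mxE /=; ring.
Qed.

Lemma omega_bv_neq s s' i j : i != j -> om (bv s i) (bv s' j) = 0.
Proof. by case: s s' => -[] /negPf h; rewrite /= omegaE ?h ?oppr0. Qed.

(** Rotations turn the short-root element of [ev i0] and [ev i] into those of
    all pairs of basis vectors from the two planes. *)
Lemma Kxs_bv s s' i : i != i0 -> Kxs (bv s i0) (bv s' i).
Proof.
move=> ii0; have i0i : i0 != i by rewrite eq_sym.
have H1 : Kxs (bv false i0) (bv false i).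
  exists (xv (ev i0) (ev i)); last by rewrite val_xv ?omegaE.
  by rewrite /xv; apply: KM (KV (Ke _)); apply: KM (KV (Ke _)); apply: Kc.
have rotate t j v : (om (bv false j) v = 0) -> (om (bv true j) v = 0) ->
    Kxs (bv false j) v -> Kxs (bv t j) v.
  case: t => //= he hf /(KxsJ (Krot j)); rewrite (rot_ev j) (rot_fix he hf).
  exact: KxsN.
have H2 : Kxs (bv s i0) (bv false i) by apply: rotate => //; apply: omega_bv_neq.
by apply/KxsC/rotate; [exact: omega_bv_neq..|exact: KxsC].
Qed.

(** [v] lies in the [K]-orbit of the first basis vector. *)
Definition reach v := exists2 h, K h & val h *m ev i0 = v.

Lemma reach_act g v : K g -> reach (val g *m v) -> reach v.
Proof.
move=> Kg [h Kh hh]; exists (g^-1 * h)%g; first by apply: KM => //; apply: KV.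
by rewrite val_SpM -mulmxA hh mul_SpVK.
Qed.

(** The termination measure of the Euclidean algorithm. *)
Definition l1norm v : nat := (\sum_a absz (v a 0%R))%N.

Lemma add_bv_coord v (c : int) s i s' i' :
  (v + c *: bv s i) (bidx s' i') 0 =
  v (bidx s' i') 0 + (if (s == s') && (i == i') then c else 0).
Proof.
rewrite bvE !mxE eqxx andbT; congr (_ + _).
have [/bidx_inj[-> ->]|ne] := eqVneq; first by rewrite !eqxx mulr1.
case: andP => [[/eqP e /eqP e']|_]; last by rewrite mulr0.
by rewrite e e' eqxx in ne.
Qed.

Lemma l1norm_step v (c : int) s i :
  `|v (bidx s i) 0 + c| < `|v (bidx s i) 0| -> (l1norm (v + c *: bv s i) < l1norm v)%N.
Proof.
move=> h; rewrite /l1norm (bigD1 (bidx s i)) //= [X in (_ < X)%N](bigD1 (bidx s i)) //=.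
rewrite add_bv_coord !eqxx /= -addSn leq_add //.
by apply/eq_leq/eq_bigr => a ne; rewrite bvE !mxE (negPf ne) mulr0 addr0.
Qed.

(** One step of the Euclidean algorithm: if [1 + M] adds to one coordinate a
    number [d] that is not larger, then [1 + M] or [1 - M] decreases it. *)
Lemma euclid_step M v (d : int) s i : Kx M -> M *m M = 0 ->
    M *m v = d *: bv s i -> d != 0 -> `|d| <= `|v (bidx s i) 0| ->
  exists g c, [/\ K g, val g *m v = v + c *: bv s i, `|c| = `|d|
    & `|v (bidx s i) 0 + c| < `|v (bidx s i) 0| ].
Proof.
move=> KxM M2 Mv d0 dle; have [g Kg hg] := KxM; have [g' Kg' hg'] := KxN M2 KxM.
have [h|h] := boolP (`|v (bidx s i) 0 + d| < `|v (bidx s i) 0|).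
  by exists g, d; split => //; rewrite hg mulmxDl mul1mx Mv.
exists g', (- d); split => //; rewrite ?normrN //; last by lia.
by rewrite hg' mulmxDl mul1mx mulNmx Mv scaleNr.
Qed.

Lemma reach_base s (c : int) : c = 1 \/ c = -1 -> reach (c *: bv s i0).
Proof.
have reachN v : reach (- v) -> reach v.
  move=> [h Kh hh]; exists (h * rot i0 * rot i0)%g.
    by apply: KM (Krot _); apply: KM (Krot _).
  transitivity (val h *m (val (rot i0) *m (val (rot i0) *m ev i0))).
    by rewrite (val_SpM (h * rot i0)%g) (val_SpM h) !mulmxA.
  by rewrite rot_ev mulmxN rot_fv mulmxN hh opprK.
have base t : reach (bv t i0).
  case: t; last by exists 1%g; rewrite // val_Sp1 mul1mx.
  by apply: reachN; exists (rot i0); [exact: Krot | rewrite rot_ev].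
by case=> ->; rewrite ?scale1r // scaleN1r; apply: reachN; rewrite opprK.
Qed.

(** Euclidean algorithm for primitive vectors with a nonzero component in the
    [i0]-th plane, a property that every step preserves. *)
Lemma reach_primitive_aux N v : (l1norm v < N)%N ->
    (exists s, v (bidx s i0) 0 != 0) -> (exists y, y *m v = 1%:M) -> reach v.
Proof.
elim: N v => // N IH v hN hv0 [y hy].
have red g c s i : K g -> val g *m v = v + c *: bv s i ->
    `|v (bidx s i) 0 + c| < `|v (bidx s i) 0| ->
    (exists t, (v + c *: bv s i) (bidx t i0) 0 != 0) -> reach v.
  move=> Kg gv lt ex; apply: (reach_act Kg); apply: IH; rewrite ?gv //.
    exact: leq_trans (l1norm_step lt) hN.
  by exists (y *m val g^-1%g); rewrite -gv mulmxA -(mulmxA y) val_SpVM mulmx1.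
(* two nonzero coordinates in one plane: a basis transvection reduces the
   larger one *)
have [/existsP[i /andP[x0 y0]]|hA] :=
    boolP [exists i, (v (bidx false i) 0 != 0) && (v (bidx true i) 0 != 0)].
  have key s : `|v (bidx (~~ s) i) 0| <= `|v (bidx s i) 0| -> reach v.
    move=> le.
    have Ks : Kx (tn (bv s i) (bv s i)) 
      by apply: Kx_tv; case: (s); [exact: Kf | exact: Ke].
    have c0 t : v (bidx t i) 0 != 0 by case: t.
    have [||||g [c [Kg gv _ lt]]] := @euclid_step _ v (om (bv s i) v) s i Ks.
    - exact: tens_id2 (JmxT n) _.
    - exact: tensMv.
    - by rewrite -[s in bv s]negbK omega_bv_eq0.
    - by rewrite -[s in bv s]negbK omega_bv_abs.
    apply: (red _ _ _ _ Kg gv lt); have [e|ne] := eqVneq i i0.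
      by exists (~~ s); rewrite -e add_bv_coord; case: (s) => /=; rewrite addr0.
    have [t ht] := hv0; exists t.
    by rewrite add_bv_coord (negPf ne) andbF addr0.
  have [le|lt] := lerP `|v (bidx true i) 0| `|v (bidx false i) 0|.
    exact: (key false).
  by apply: (key true); apply: ltW.
have zero s i : v (bidx s i) 0 != 0 -> v (bidx (~~ s) i) 0 = 0.
  move=> h; apply/eqP; apply: contraNT hA => h'; apply/existsP; exists i.
  by case: s h h' => /= -> ->.
(* a nonzero coordinate in another plane: a short-root element reduces the
   larger of the two, and the one in another plane in case of a tie *)
have [s p0] := hv0; set p := v (bidx s i0) 0 in p0.
have [/existsP[i /existsP[s' /andP[ii0 q0]]]|hB] :=
    boolP [exists i, exists s', (i != i0) && (v (bidx s' i) 0 != 0)].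
  set q := v _ 0 in q0.
  have z1 t j : v (bidx t j) 0 != 0 -> om (bv t j) v = 0.
    by move=> h; apply/eqP; rewrite -[t in bv t]negbK omega_bv_eq0 zero.
  have [le|lt] := lerP `|p| `|q|.
    have Ks := Kxs_bv (~~ s) s' ii0.
    have [||||g [c [Kg gv _ lt]]] := @euclid_step _ v (om (bv (~~ s) i0) v) s' i Ks.
    - by rewrite tens_sym2 // omega_bv_neq // eq_sym.
    - by rewrite mulmxDl !tensMv (z1 _ _ q0) scale0r add0r.
    - by rewrite omega_bv_eq0.
    - by rewrite omega_bv_abs.
    apply: (red _ _ _ _ Kg gv lt); exists s.
    by rewrite add_bv_coord (negPf ii0) andbF addr0.
  have Ks := Kxs_bv s (~~ s') ii0.
  have [||||g [c [Kg gv ec ltc]]] := @euclid_step _ v (om (bv (~~ s') i) v) s i0 Ks.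
  - by rewrite tens_sym2 // omega_bv_neq // eq_sym.
  - by rewrite mulmxDl !tensMv (z1 _ _ p0) scale0r addr0.
  - by rewrite omega_bv_eq0.
  - by rewrite omega_bv_abs ltW.
  apply: (red _ _ _ _ Kg gv ltc); exists s.
  rewrite add_bv_coord !eqxx /= -/p; move: ec; rewrite omega_bv_abs -/q => ec.
  by lia.
(* one nonzero coordinate is left, and primitivity makes it a unit *)
have vE : v = p *: bv s i0.
  apply/colP => a; rewrite bvE !mxE andbT.
  have [t [i ->]] : exists t i, a = bidx t i.
    by case: (idxP a) => -[i ->]; [exists false, i | exists true, i].
  have [/bidx_inj[-> ->]|ne] := eqVneq; first by rewrite mulr1.
  rewrite mulr0; have [e|ni] := eqVneq i i0.
    rewrite e in ne *; have -> : t = ~~ s by case: (t) (s) ne => -[]; rewrite ?eqxx.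
    exact: zero.
  apply/eqP; apply: contraNT hB => h; apply/existsP; exists i.
  by apply/existsP; exists t; rewrite ni.
rewrite vE; apply: reach_base; move: hy; rewrite vE -scalemxAr => /matrixP/(_ 0 0).
rewrite !mxE mulrC /= => hp; have /intUnitRing.unitzPl up := hp.
by move: up; rewrite qualifE /= => /orP[]/eqP->; [left | right].
Qed.

Lemma reach_primitive v : (exists y, y *m v = 1%:M) -> reach v.
Proof.
move=> [y hy].
have [/existsP[s hs]|] := boolP [exists s, v (bidx s i0) 0 != 0].
  by apply: (@reach_primitive_aux (l1norm v).+1); [|exists s|exists y].
rewrite negb_exists => /forallP hv.
have hv0 s : v (bidx s i0) 0 = 0 by have := hv s; rewrite negbK => /eqP.
have [a ha] : exists a, v a 0 != 0.
  apply/existsP; apply: contraT; rewrite negb_exists => /forallP h.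
  have v0 : v = 0 by apply/colP => a; have := h a; rewrite negbK mxE => /eqP.
  by move: hy; rewrite v0 mulmx0 => /matrixP/(_ 0 0); rewrite !mxE.
have [t [i ei]] : exists t i, a = bidx t i.
  by case: (idxP a) => -[i ->]; [exists false, i | exists true, i].
rewrite ei in ha; have ii0 : i != i0.
  by apply/eqP => e; rewrite e hv0 eqxx in ha.
(* a short-root element copies the coordinate [a] into the [i0]-th plane *)
have [g Kg hg] := Kxs_bv false (~~ t) ii0.
have gv : val g *m v = v + om (bv (~~ t) i) v *: bv false i0.
  rewrite hg mulmxDl mul1mx mulmxDl !tensMv.
  suff -> : om (bv false i0) v = 0 by rewrite scale0r addr0.
  by apply/eqP; rewrite (omega_bv_eq0 true) hv0.
apply: (reach_act Kg); apply: (@reach_primitive_aux (l1norm (val g *m v)).+1) => //.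
  exists false; rewrite gv add_bv_coord !eqxx hv0 add0r.
  by rewrite omega_bv_eq0.
by exists (y *m val g^-1%g); rewrite mulmxA -(mulmxA y) val_SpVM mulmx1.
Qed.

(** [K] moves the first basis vector to every image of every basis vector. *)
Lemma reach_orbit g s i : reach (val g *m bv s i).
Proof.
apply: reach_primitive; exists ((delta_mx 0 (bidx s i)) *m val g^-1%g).
rewrite -mulmxA mul_SpVK bvE mul_delta_mx; apply/matrixP => a b.
by rewrite !mxE !ord1.
Qed.

End Transitivity.

(** * Two-by-two matrices *)

Section Mx2Ring.
Variable R : comNzRingType.
Implicit Types (A B C : 'M[R]_2).

Lemma mulmx2E A B i j : (A *m B) i j = A i 0 * B 0 j + A i 1 * B 1 j.
Proof.
rewrite mxE !big_ord_recl big_ord0 addr0.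
by congr (_ * B _ _ + A _ _ * B _ _); apply: val_inj.
Qed.

Lemma mx2P A B : A 0 0 = B 0 0 -> A 0 1 = B 0 1 -> A 1 0 = B 1 0 ->
  A 1 1 = B 1 1 -> A = B.
Proof.
move=> h0 h1 h2 h3; apply/matrixP => i j.
have o2 (k : 'I_2) : k = 0 \/ k = 1.
  by case: k => -[|[|//]] h; [left | right]; apply: val_inj.
by case: (o2 i) (o2 j) => -> [->|->].
Qed.

Lemma mxtrace2E A : \tr A = A 0 0 + A 1 1.
Proof.
rewrite /mxtrace !big_ord_recl big_ord0 addr0.
by congr (_ + A _ _); apply: val_inj.
Qed.

Lemma scalar_mx2E (a : R) (i j : 'I_2) : a%:M i j = if i == j then a else 0.
Proof. by rewrite mxE; case: (i == j). Qed.

Lemma lin_mx2E (a b : R) A (i j : 'I_2) :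
  (a *: A + b%:M) i j = a * A i j + (if i == j then b else 0).
Proof. by rewrite mxE scalar_mx2E mxE. Qed.

(** Cayley-Hamilton for matrices of determinant one. *)
Lemma mx2_CH A : A 0 0 * A 1 1 - A 0 1 * A 1 0 = 1 ->
  A *m A = \tr A *: A - 1%:M.
Proof.
move=> d1; have -> : - 1%:M = (-1)%:M :> 'M[R]_2 by rewrite raddfN.
by apply: mx2P; rewrite mulmx2E lin_mx2E mxtrace2E /= -?d1; ring.
Qed.

End Mx2Ring.

Section Mx2.
Variable F : fieldType.
Implicit Types (A B C K Y : 'M[F]_2).

(** The matrices commuting with a non-scalar one are its affine functions. *)
Lemma mx2_comm_lin A B : A *m B = B *m A ->
  (exists a : F, A = a%:M) \/ exists a b : F, B = a *: A + b%:M.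
Proof.
move=> /matrixP h; move: (h 0 0) (h 0 1) (h 1 0); rewrite !mulmx2E => e1 e2 e3.
have lin (x y z : F) : x != 0 -> x * y = x * z -> y = z by move=> x0; apply: mulfI.
have [A01|A01] := eqVneq (A 0 1) 0; last first.
  right; exists (B 0 1 / A 0 1), (B 0 0 - B 0 1 / A 0 1 * A 0 0).
  apply: mx2P; rewrite lin_mx2E /=.
  - by ring.
  - by field.
  - apply: (lin _ _ _ A01); rewrite addr0 mulrA mulrCA mulfV // mulr1.
    by apply: (addrI (A 0 0 * B 0 0)); rewrite e1 mulrC.
  - apply: (lin _ _ _ A01); apply: (addrI (A 0 0 * B 0 1)); rewrite e2.
    by field.
have [A10|A10] := eqVneq (A 1 0) 0; last first.
  right; exists (B 1 0 / A 1 0), (B 0 0 - B 1 0 / A 1 0 * A 0 0).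
  rewrite A01 in e1 e2.
  apply: mx2P; rewrite lin_mx2E /=.
  - by ring.
  - rewrite A01 mulr0 addr0; apply: (lin _ _ _ A10); rewrite mulr0 mulrC.
    by apply: (addrI (B 0 0 * A 0 0)); rewrite -e1; ring.
  - by field.
  - apply: (lin _ _ _ A10); apply: (addrI (B 1 0 * A 0 0)).
    have -> : B 1 0 * A 0 0 + A 1 0 * B 1 1 = B 1 0 * A 0 0 + B 1 1 * A 1 0 by ring.
    by rewrite -e3; field.
have [A00|A00] := eqVneq (A 0 0) (A 1 1).
  by left; exists (A 0 0); apply: mx2P; rewrite scalar_mx2E //=.
have d0 : A 0 0 - A 1 1 != 0 by rewrite subr_eq0.
right; exists ((B 0 0 - B 1 1) / (A 0 0 - A 1 1)),
  (B 0 0 - (B 0 0 - B 1 1) / (A 0 0 - A 1 1) * A 0 0).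
rewrite A01 A10 in e1 e2 e3.
apply: mx2P; rewrite lin_mx2E /=.
- by ring.
- rewrite A01 mulr0 addr0; apply: (lin _ _ _ d0); rewrite mulr0 mulrBl.
  have -> : A 0 0 * B 0 1 = A 1 1 * B 0 1; last by rewrite subrr.
  by move: e2; rewrite mul0r mulr0 addr0 add0r => ->; rewrite mulrC.
- rewrite A10 mulr0 addr0; apply: (lin _ _ _ d0); rewrite mulr0 mulrBl.
  have -> : A 1 1 * B 1 0 = A 0 0 * B 1 0; last by rewrite subrr.
  by move: e3; rewrite mul0r mulr0 addr0 add0r => ->; rewrite mulrC.
- by field.
Qed.

(** Two matrices commuting with a non-scalar matrix commute. *)
Lemma mx2_centralizer A B C : A *m B = B *m A -> A *m C = C *m A ->
  B *m C = C *m B \/ exists a : F, A = a%:M.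
Proof.
move=> hB hC; case: (mx2_comm_lin hB) => [|[a [b ->]]]; first by right.
left; rewrite mulmxDl mulmxDr -scalemxAl -scalemxAr hC.
by rewrite mul_scalar_mx mul_mx_scalar.
Qed.

(** An isometry of a nonzero alternating plane has determinant one: its
    Cayley-Hamilton equation is [Y ^ 2 = tr Y * Y - 1]. *)
Lemma mx2_isometry K Y : K 0 0 = 0 -> K 1 1 = 0 -> K 1 0 = - K 0 1 ->
  K 0 1 != 0 -> Y^T *m K *m Y = K -> Y *m Y = \tr Y *: Y - 1%:M.
Proof.
move=> k00 k11 k10 k01 /matrixP/(_ 0 1).
rewrite !mulmx2E ![_^T _ _]mxE k00 k11 k10 => e.
apply: mx2_CH; apply: (mulfI k01); rewrite mulr1 -[RHS]e; ring.
Qed.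

End Mx2.

Section Mx2Braid.
Variables (F : numFieldType) (Y Z : 'M[F]_2).
Hypotheses (cY : Y *m Y = \tr Y *: Y - 1%:M) (cZ : Z *m Z = \tr Z *: Z - 1%:M)
  (cYZ : (Y *m Z) *m (Y *m Z) = \tr (Y *m Z) *: (Y *m Z) - 1%:M).
Hypotheses (YZ : Y *m Z <> Z *m Y) (br : Y *m Z *m Y = Z *m Y *m Z).

Lemma mx2_CH_inv (A : 'M[F]_2) : A *m A = \tr A *: A - 1%:M ->
  A *m (\tr A *: 1%:M - A) = 1%:M /\ (\tr A *: 1%:M - A) *m A = 1%:M.
Proof.
move=> cA; rewrite mulmxBr mulmxBl -scalemxAr -scalemxAl mulmx1 mul1mx cA.
by rewrite opprB addrC subrK.
Qed.

(** The braid relation and Cayley-Hamilton for [Y * Z] give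
    [(tr (Y * Z) - 1) * (Y - Z) = 0]. *)
Lemma mx2_braid_trace : \tr Z = \tr Y /\ \tr (Y *m Z) = 1.
Proof.
have [PQ QP] := mx2_CH_inv cYZ; set Q := _ - _ in PQ QP.
have tZ : \tr Z = \tr Y.
  have -> : Z = (Y *m Z) *m Y *m Q by rewrite br -(mulmxA Z Y Z) -(mulmxA Z) PQ mulmx1.
  by rewrite -mulmxA mxtrace_mulC -mulmxA QP mulmx1.
split=> //; have [YV VY] := mx2_CH_inv cY; have [ZV VZ] := mx2_CH_inv cZ.
set V := _ - Y in YV VY; set V' := _ - Z in ZV VZ; set s := \tr (Y *m Z).
have e1 : Y *m Z *m Y = s *: Y - V'.
  transitivity ((Y *m Z) *m (Y *m Z) *m V').
    by rewrite -!mulmxA ZV mulmx1.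
  by rewrite cYZ mulmxBl mul1mx -scalemxAl -mulmxA ZV mulmx1.
have e2 : Z *m Y *m Z = s *: Z - V.
  transitivity (V *m ((Y *m Z) *m (Y *m Z))).
    by rewrite !mulmxA VY mul1mx.
  by rewrite cYZ mulmxBr mulmx1 -scalemxAr mulmxA VY mul1mx.
have /eqP : (s - 1) *: (Y - Z) = 0.
  have : s *: Y - V' = s *: Z - V by rewrite -e1 -e2.
  rewrite /V /V' tZ => /matrixP e; apply/matrixP => i j; have := e i j.
  rewrite !mxE => h; move: (Y i j) (Z i j) h => y z h.
  have -> : (s - 1) * (y - z) = (s * y - (\tr Y * (i == j)%:R - z))
    - (s * z - (\tr Y * (i == j)%:R - y)) by ring.
  by rewrite h subrr.
rewrite scalemx_eq0 !subr_eq0 => /orP[/eqP //|/eqP e].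
by case: YZ; rewrite e.
Qed.

(** A braiding pair of trace [2] or [-2] is, up to sign, a pair of unipotents
    whose logarithms have product of trace [-1]. *)
Lemma mx2_braid_nil : \tr (Y *m Y) = 2 ->
  let M := 2^-1 *: (Y *m Y - 1%:M) in let M' := 2^-1 *: (Z *m Z - 1%:M) in
  [/\ M *m M = 0, M <> 0 & \tr (M *m M') = -1].
Proof.
have [tZ tYZ] := mx2_braid_trace; move: cY cZ; rewrite tZ; set t := \tr Y => hY hZ.
rewrite hY raddfB /= linearZ /= -/t mxtrace1 => /eqP; rewrite subr_eq -natrD => /eqP t2.
have two0 : 2 != 0 :> F by rewrite pnatr_eq0.
have mE (A : 'M[F]_2) : A *m A = t *: A - 1%:M ->
    2^-1 *: (A *m A - 1%:M) = (t / 2) *: A - 1%:M.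
  move=> ->; apply/matrixP => i j; rewrite !mxE; by field.
rewrite -hY /= !mE //.
have t4 : t / 2 * (t / 2) = 1.
  have -> : t / 2 * (t / 2) = t * t / 4 by field.
  by rewrite t2 mulfV // pnatr_eq0.
split.
- rewrite mulmxBr !mulmxBl !mulmx1 mul1mx -scalemxAl -scalemxAr scalerA t4 scale1r hY.
  apply/matrixP => i j; rewrite !mxE.
  by field.
- move/eqP; rewrite subr_eq0 => /eqP e; apply: YZ.
  have -> : Y = (t / 2)%:M.
    by move/(congr1 (GRing.scale (t / 2))): e; rewrite scalerA t4 scale1r scalemx1.
  by rewrite mul_scalar_mx mul_mx_scalar.
rewrite mulmxBr !mulmxBl !mulmx1 mul1mx -scalemxAl -scalemxAr scalerA t4 scale1r.
rewrite !raddfB /= !linearZ /= tYZ tZ -/t mxtrace1.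
have -> : t / 2 * t = 2.
  have -> : t / 2 * t = t * t / 2 by field.
  by rewrite t2; field.
by ring.
Qed.

End Mx2Braid.

(** * Elementary abelian 2-groups of isometries *)

Section Idempotents.
Variables (F : numFieldType) (m : nat).
Implicit Types (p g h : 'M[F]_m).

(** An idempotent is the product of its column and row bases, of which the
    product in the other order is the identity. *)
Lemma idem_factor p : p *m p = p ->
  [/\ col_base p *m row_base p = p, row_base p *m col_base p = 1%:M
    & \tr p = (\rank p)%:R].
Proof.
move=> pp; have e := mulmx_base p.
have wu : row_base p *m col_base p = 1%:M.
  apply: (row_full_inj (col_base_full p)); apply: (row_free_inj (row_base_free p)).
  by rewrite mulmx1 e mulmxA -mulmxA e pp.
by split=> //; rewrite -[X in \tr X]e mxtrace_mulC wu mxtrace1.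
Qed.

Variable J : 'M[F]_m.
Hypotheses (JT : J^T = - J) (Junit : J \in unitmx).

(** A self-adjoint idempotent cannot have rank one, the form being alternating. *)
Lemma idem_rank_neq1 p : p *m p = p -> p^T *m J = J *m p -> \rank p <> 1%N.
Proof.
move=> pp pJ r1; have [uw _ _] := idem_factor pp.
have Jp : J *m p = p^T *m J *m p by rewrite pJ -mulmxA pp.
have K0 : (col_base p)^T *m J *m col_base p = 0.
  move: (col_base p); rewrite r1 => u; rewrite mx11_omega.
  by rewrite (omega_id JT) raddf0.
suff p0 : p = 0 by rewrite p0 mxrank0 in r1.
suff: J *m p = 0 by rewrite -{2}(mulKmx Junit p) => ->; rewrite mulmx0.
move: (col_base p) (row_base p) uw K0 => U W uw K0.
have -> : J *m p = W^T *m (U^T *m J *m U) *m W.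
  by rewrite Jp !mulmxA -trmx_mul uw -!mulmxA uw.
by rewrite K0 mulmx0 mul0mx.
Qed.

Section Plane.
Variable p : 'M[F]_m.
Hypotheses (pp : p *m p = p) (pJ : p^T *m J = J *m p) (p2 : \rank p = 2).

(** Coordinates on the plane that is the image of [p]. *)
Lemma plane_factor : exists (U : 'M[F]_(m, 2)) (W : 'M[F]_(2, m)),
  U *m W = p /\ W *m U = 1%:M.
Proof.
have [] := idem_factor pp.
by move: (col_base p) (row_base p); rewrite p2 => U W uw wu _; exists U, W.
Qed.

(** On a plane, maps commuting with a non-scalar map commute. *)
Lemma plane_centralizer g h k :
    g *m p = p *m g -> h *m p = p *m h -> k *m p = p *m k ->
    g *m h = h *m g -> g *m k = k *m g ->
  p *m (h *m k) = p *m (k *m h) \/ exists a : F, p *m g = a *: p.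
Proof.
have [U [W [uw wu]]] := plane_factor; rewrite -uw.
have [P eP] : exists P, P = U *m W by eexists.
rewrite -eP; have PP : P *m P = P by rewrite eP uw pp.
have ext z : z *m P = P *m z -> P *m z = U *m (W *m z *m U) *m W.
  move=> hz; have -> : U *m (W *m z *m U) *m W = P *m (z *m P).
    by rewrite eP !mulmxA.
  by rewrite hz mulmxA PP.
have wP : W *m P = W by rewrite eP mulmxA wu mul1mx.
have mor x y : x *m P = P *m x ->
    W *m (x *m y) *m U = (W *m x *m U) *m (W *m y *m U).
  move=> hx; have -> : (W *m x *m U) *m (W *m y *m U) = W *m (x *m P) *m y *m U.
    by rewrite eP !mulmxA.
  by rewrite hx (mulmxA W P) wP !mulmxA.
move=> hg hh hk gh gk.
have [] := @mx2_centralizer _ (W *m g *m U) (W *m h *m U) (W *m k *m U).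
- by rewrite -!mor // gh.
- by rewrite -!mor // gk.
- rewrite -!mor // => e; left.
  have hkP : h *m k *m P = P *m (h *m k) by rewrite -mulmxA hk mulmxA hh mulmxA.
  have khP : k *m h *m P = P *m (k *m h) by rewrite -mulmxA hh mulmxA hk mulmxA.
  by rewrite (ext _ hkP) (ext _ khP) e.
by case=> a ea; right; exists a; rewrite (ext _ hg) ea mul_mx_scalar -scalemxAl eP.
Qed.

(** The Gram matrix of the plane is a nonzero alternating matrix, so an
    isometry preserving the plane has determinant one on it. *)
Lemma plane_CH (U : 'M[F]_(m, 2)) (W : 'M[F]_(2, m)) g :
    U *m W = p -> W *m U = 1%:M -> g *m p = p *m g -> g^T *m J *m g = J ->
  (W *m g *m U) *m (W *m g *m U) = \tr (W *m g *m U) *: (W *m g *m U) - 1%:M.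
Proof.
move=> uw wu gp gJ; have [K eK] : exists K, K = U^T *m J *m U by eexists.
have KT : K^T = - K by rewrite eK !trmx_mul trmxK JT mulNmx mulmxN mulmxA.
have Kij i j : K i j = - K j i by move/matrixP/(_ j i): KT; rewrite !mxE.
have diag i : K i i = 0.
  by have /eqP := Kij i i; rewrite -subr_eq0 opprK -mulr2n mulrn_eq0 /= => /eqP.
apply: (@mx2_isometry _ K) => //.
  apply: contraTneq isT => k01; have K0 : K = 0.
    by apply: mx2P; rewrite ?diag ?(Kij 1 0) ?k01 !mxE ?oppr0.
  have Jp : J *m p = 0.
    rewrite -pp mulmxA -pJ -uw trmx_mul -!mulmxA (mulmxA J U W).
    by rewrite (mulmxA U^T) (mulmxA U^T) -eK K0 mul0mx mulmx0.
  have p0 : p = 0 by rewrite -(mulKmx Junit p) Jp mulmx0.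
  by move: p2; rewrite p0 mxrank0.
have pU : p *m U = U by rewrite -uw -mulmxA wu mulmx1.
have -> : W *m g *m U = W *m (g *m U) by rewrite mulmxA.
rewrite eK trmx_mul -!mulmxA (mulmxA U W) uw (mulmxA p) -gp -(mulmxA g) pU.
rewrite !trmx_mul -!mulmxA (mulmxA W^T) -trmx_mul uw (mulmxA p^T) pJ.
rewrite -(mulmxA J) (mulmxA p) -gp -(mulmxA g) pU.
by rewrite (mulmxA J) (mulmxA g^T) (mulmxA g^T) gJ mulmxA.
Qed.

Lemma plane_scalar_sq g (a : F) : g *m p = p *m g -> g^T *m J *m g = J ->
  p *m g = a *: p -> p *m (g *m g) = p.
Proof.
move=> gp gJ pg; have [U [W [uw wu]]] := plane_factor.
have e : W *m g *m U = a%:M.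
  have -> : W *m g *m U = W *m (p *m g) *m U by rewrite -uw !mulmxA wu mul1mx.
  by rewrite pg -uw -scalemxAr -scalemxAl mulmxA wu mul1mx wu scalemx1.
have := plane_CH uw wu gp gJ; rewrite e => /(congr1 (fun M : 'M_2 => M 0 0)).
have -> : - 1%:M = (-1)%:M :> 'M[F]_2 by rewrite raddfN.
rewrite mulmx2E lin_mx2E mxtrace2E !scalar_mx2E /= => h.
have a2 : a * a = 1.
  have -> : a * a = (a + a) * a - a * a by ring.
  have -> : (a + a) * a = a * a + 1 by rewrite -[a * a](addr0) -[X in a * a + X](mul0r 0) h; ring.
  by rewrite addrC addKr.
by rewrite mulmxA pg -scalemxAl pg scalerA a2 scale1r.
Qed.

End Plane.
End Idempotents.

(** An infinitesimal isometry of rank one is a multiple of some [tens x x]. *)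
Lemma rank1_tens (F : numFieldType) m (J N : 'M[F]_m) : J^T = - J -> J \in unitmx ->
  N^T *m J = - (J *m N) -> \rank N = 1%N ->
  exists (k : F) (x : 'cV[F]_m), [/\ k != 0, x != 0 & N = k *: tens J x x].
Proof.
move=> JT Junit NJ r1; have eN := mulmx_base N.
have := row_base_free N; move: (col_base N) (row_base N) eN; rewrite r1.
move=> x y eN yfree; have [z ez] : exists z, z = J *m x by eexists.
have zT : x^T *m J = - z^T by rewrite ez trmx_mul JT mulmxN opprK.
have zy i j : y 0 i * z j 0 = z i 0 * y 0 j.
  move: NJ; rewrite -eN trmx_mul -mulmxA zT mulmxN mulmxA -ez => /oppr_inj/matrixP/(_ i j).
  by rewrite !mxE !big_ord1 !mxE.
have N0 : N != 0 by rewrite -mxrank_eq0 r1.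
have x0 : x != 0 by apply: contraNneq N0 => x0; rewrite -eN x0 mul0mx.
have z0 : z != 0.
  by apply: contraNneq x0 => z0; rewrite -(mulKmx Junit x) -ez z0 mulmx0.
have y0 : y != 0 by apply: contraNneq N0 => y0; rewrite -eN y0 mulmx0.
have [j yj] : exists j, y 0 j != 0.
  apply/existsP; apply: contraNT y0; rewrite negb_exists => /forallP h.
  by apply/eqP/rowP => j; have := h j; rewrite negbK mxE => /eqP.
have [c c0 zE] : exists2 c : F, c != 0 & z = c *: y^T.
  have zE : z = (z j 0 / y 0 j) *: y^T.
    apply/colP => i; rewrite !mxE; apply: (mulIf yj).
    by rewrite -zy mulrAC divfK // mulrC.
  by exists (z j 0 / y 0 j) => //; apply: contraNneq z0 => c0; rewrite zE c0 scale0r.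
exists (- c^-1), x; split=> //; first by rewrite oppr_eq0 invr_eq0.
rewrite /tens -mulmxA zT mulmxN scalerN scaleNr opprK zE linearZ /= trmxK -scalemxAr.
by rewrite scalerA mulVf // scale1r eN.
Qed.

(** The centralizer of [D] preserves a projection that is a multiple of [D]
    on both sides by the same factor. *)
Lemma comm_plane (F : numFieldType) m (p D R X : 'M[F]_m) :
  p = D *m R -> p = R *m D -> p *m D = D -> D *m p = D -> X *m D = D *m X ->
  X *m p = p *m X.
Proof.
move=> pDR pRD pD Dp XD.
have e1 : p *m X *m p = X *m p.
  by rewrite {2 3}pDR !mulmxA -(mulmxA p X D) XD mulmxA pD.
have e2 : p *m X *m p = p *m X.
  by rewrite {1 3}pRD -(mulmxA R D X) -XD -(mulmxA R) -(mulmxA X) Dp.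
by rewrite -e1 e2.
Qed.

(** If [E] is the identity off the plane of [p] and has determinant one and
    trace [t] different from [2] on it, then by Cayley-Hamilton [p] is a
    multiple of [E - 1], so that the centralizer of [E] preserves the plane. *)
Lemma comm_nonunipotent (F : numFieldType) m (p E X : 'M[F]_m) (t : F) :
  p *m p = p -> E *m p = p *m E -> E *m (1%:M - p) = 1%:M - p ->
  E *m E *m p = t *: (E *m p) - p -> t != 2 -> X *m E = E *m X ->
  X *m p = p *m X.
Proof.
move=> pp Ep E1 CH t2 XE; set D := E - 1%:M.
have Dp : D *m p = D.
  move: E1; rewrite mulmxBr mulmx1 => E1.
  rewrite mulmxBl mul1mx -[E *m p](subKr E) E1.
  rewrite opprB.
  by rewrite [p - _]addrC addrA addrK.
have pD : p *m D = D by rewrite -[RHS]Dp mulmxBl mulmxBr mul1mx mulmx1 Ep.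
pose R := (t - 2)^-1 *: ((t *: 1%:M - E) *m D).
have key : D *m D *m p = (t - 2) *: (E *m p).
  rewrite !mulmxBl !mulmxBr !mulmxBl !mulmx1 !mul1mx CH.
  by apply/matrixP => i j; rewrite !mxE; ring.
have DR : D *m (t *: 1%:M - E) = (t *: 1%:M - E) *m D.
  rewrite !mulmxBl !mulmxBr -?scalemxAr -?scalemxAl !mulmx1 !mul1mx.
  by apply/matrixP => i j; rewrite !mxE; ring.
have pRD : p = R *m D.
  rewrite -[D in RHS]Dp /R -scalemxAl -!mulmxA (mulmxA D) key -scalemxAr scalerA.
  rewrite mulVf ?subr_eq0 // scale1r mulmxBl (mulmxA E E) CH -scalemxAl mul1mx.
  by rewrite opprB addrC subrK.
have pDR : p = D *m R by rewrite {1}pRD /R -scalemxAl -scalemxAr mulmxA DR.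
apply: (comm_plane pDR pRD pD Dp).
by rewrite mulmxBr mulmxBl XE mulmx1 mul1mx.
Qed.

(** ** Simultaneous diagonalization *)

Section Characters.
Variable n : nat.

(** [bvec n] is the underlying set of the group (Z/2)^n, with addition [bxor];
    the characters [bchar] of this group are indexed by [bvec n] too. *)
Definition bvec := {ffun 'I_n -> bool}.
Implicit Types C D S T : bvec.
Definition bxor C D : bvec := [ffun i => C i (+) D i].
Definition bzero : bvec := [ffun => false].

Lemma bxorK C : involutive (bxor C).
Proof. by move=> D; apply/ffunP => i; rewrite !ffunE addbA addbb. Qed.

Lemma bxor0 C D : (bxor C D == bzero) = (C == D).
Proof.
apply/eqP/eqP => [e|->]; last by apply/ffunP => i; rewrite !ffunE addbb.
by rewrite -[D](bxorK C) e; apply/ffunP => i; rewrite !ffunE addbF.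
Qed.

Variable F : numFieldType.
Definition bchar C S : F := \prod_i (-1) ^+ (C i && S i).

Lemma bcharC C S : bchar C S = bchar S C.
Proof. by apply: eq_bigr => i _; rewrite andbC. Qed.

Lemma bcharD C D S : bchar (bxor C D) S = bchar C S * bchar D S.
Proof.
rewrite -big_split; apply: eq_bigr => i _ /=.
by rewrite ffunE andb_addl signr_addb.
Qed.

Lemma bchar_sq C S : bchar C S * bchar C S = 1.
Proof.
rewrite -bcharD; apply: big1 => i _.
by rewrite ffunE addbb.
Qed.

Lemma bchar_cases C S : bchar C S = 1 \/ bchar C S = -1.
Proof.
have /eqP := bchar_sq C S; rewrite -expr2 sqrf_eq1 => /orP[]/eqP; by [left|right].
Qed.

Lemma bchar_bzero C : bchar C bzero = 1.
Proof. by apply: big1 => i _; rewrite ffunE andbF. Qed.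

Lemma bchar_sep C : C != bzero -> exists D, bchar C D = -1.
Proof.
move=> C0; have [i Ci] : exists i, C i.
  apply/existsP; apply: contraNT C0; rewrite negb_exists => /forallP h.
  by apply/eqP/ffunP => i; rewrite ffunE; apply/negbTE.
exists [ffun j => j == i]; rewrite /bchar (bigD1 i) //= big1 => [|j ji].
  by rewrite ffunE eqxx Ci mulr1.
by rewrite ffunE (negPf ji) andbF.
Qed.

(** Orthogonality of characters. *)
Lemma bchar_sum C : \sum_S bchar C S = if C == bzero then 2 ^+ n else 0.
Proof.
case: eqP => [->|/eqP C0].
  rewrite (eq_bigr (fun=> 1)) => [|S _]; last by rewrite bcharC bchar_bzero.
  by rewrite sumr_const card_ffun card_bool card_ord natrX.
have [D hD] := bchar_sep C0.
have e : \sum_S bchar C S = - \sum_S bchar C S.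
  rewrite {1}(reindex_inj (inv_inj (bxorK D))) -sumrN; apply: eq_bigr => S _ /=.
  by rewrite bcharC bcharD bcharC hD bcharC mulN1r.
by move/eqP: e; rewrite -subr_eq0 opprK -mulr2n mulrn_eq0 /= => /eqP.
Qed.

Variables (m : nat) (J : 'M[F]_m).
Hypotheses (JT : J^T = - J) (Junit : J \in unitmx) (mE : m = (2 * n)%N).
Variable B : bvec -> 'M[F]_m.
Hypotheses (BM : forall S T, B (bxor S T) = B S *m B T) (B0 : B bzero = 1%:M).
Hypotheses (Binj : injective B) (Biso : forall S, (B S)^T *m J *m B S = J).

(** Projection on the isotypic component of character [C]. *)
Definition bproj C : 'M[F]_m := (2 ^+ n)^-1 *: \sum_S bchar C S *: B S.

Lemma mulB_bproj T C : B T *m bproj C = bchar C T *: bproj C.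
Proof.
rewrite /bproj -scalemxAr scalerA mulrC -scalerA; congr (_ *: _).
rewrite mulmx_sumr scaler_sumr (reindex_inj (inv_inj (bxorK T))) /=.
apply: eq_bigr => S _; rewrite -scalemxAr -BM bxorK scalerA.
by rewrite bcharC bcharD !(bcharC _ C).
Qed.

Lemma sum_bproj : \sum_C bproj C = 1%:M.
Proof.
rewrite /bproj -scaler_sumr exchange_big /= (bigD1 bzero) //= [X in _ + X]big1 => [|S S0].
  rewrite addr0 -scaler_suml (eq_bigr (fun=> 1)) => [|C _]; last exact: bchar_bzero.
  rewrite sumr_const card_ffun card_bool card_ord natrX scalerA B0.
  by rewrite mulVf ?scale1r // expf_neq0 // pnatr_eq0.
rewrite -scaler_suml (eq_bigr (bchar S)) => [|C _]; last exact: bcharC.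
by rewrite bchar_sum (negPf S0) scale0r.
Qed.

Lemma bproj_orth C D : bproj C *m bproj D = if C == D then bproj D else 0.
Proof.
rewrite {1}/bproj -scalemxAl mulmx_suml.
under eq_bigr do rewrite -scalemxAl mulB_bproj scalerA -bcharD.
rewrite -scaler_suml bchar_sum bxor0; case: eqP => _.
  by rewrite scalerA mulVf ?scale1r // expf_neq0 // pnatr_eq0.
by rewrite scale0r scaler0.
Qed.

Lemma bproj_idem C : bproj C *m bproj C = bproj C.
Proof. by rewrite bproj_orth eqxx. Qed.

Lemma bproj_adj C : (bproj C)^T *m J = J *m bproj C.
Proof.
have BJ S : (B S)^T *m J = J *m B S.
  rewrite -{2}(Biso S) -!mulmxA -BM.
  by have /eqP -> : bxor S S == bzero; rewrite ?bxor0 // B0 mulmx1.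
rewrite /bproj linearZ /= -scalemxAl -scalemxAr; congr (_ *: _).
rewrite raddf_sum mulmx_suml mulmx_sumr; apply: eq_bigr => S _.
by rewrite /= linearZ /= -scalemxAl -scalemxAr BJ.
Qed.

Lemma B_bproj T : B T = \sum_C bchar C T *: bproj C.
Proof.
rewrite -[LHS]mulmx1 -sum_bproj mulmx_sumr.
by apply: eq_bigr => C _; rewrite mulB_bproj.
Qed.

(** The characters that occur in the representation [B]. *)
Definition bsupp := [set C | bproj C != 0].

(** As [B] is faithful, its [2 ^ n] elements are told apart by the characters
    in [bsupp], hence [2 ^ n <= 2 ^ #|bsupp|]. *)
Lemma card_bsupp_ge : (n <= #|bsupp|)%N.
Proof.
pose f S := [set C in bsupp | bchar C S == -1].
have finj : injective f.
  move=> S T e; apply: Binj; rewrite !B_bproj; apply: eq_bigr => C _.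
  have [C0|CX] := boolP (C \in bsupp); last first.
    by move: CX; rewrite inE negbK => /eqP->; rewrite !scaler0.
  congr (_ *: _); move/setP/(_ C): e; rewrite !inE.
  have -> : bproj C != 0 by rewrite inE in C0.
  have n11 : (1 == -1 :> F) = false.
    by rewrite -subr_eq0 opprK -(natrD _ 1 1) pnatr_eq0.
  by case: (bchar_cases C S) (bchar_cases C T) => -> [->|->]; rewrite ?eqxx ?n11.
have /card_imset hc := finj.
have := subset_leq_card (_ : f @: [set: bvec] \subset powerset bsupp).
rewrite hc card_powerset cardsT card_ffun card_bool card_ord leq_exp2l //; apply.
apply/fintype.subsetP => X /imsetP[S _ ->]; rewrite inE; apply/fintype.subsetP => C.
by rewrite inE => /andP[].
Qed.

Lemma bproj_rank C : C \in bsupp -> (2 <= \rank (bproj C))%N.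
Proof.
rewrite inE -mxrank_eq0 => r0.
have := idem_rank_neq1 JT Junit (bproj_idem C) (bproj_adj C).
by case: (\rank _) r0 => [|[|]].
Qed.

Lemma sum_bproj_rank : (\sum_(C in bsupp) \rank (bproj C) = 2 * n)%N.
Proof.
apply/eqP; rewrite -(eqr_nat F) natr_sum -mE -(mxtrace1 F m) -sum_bproj raddf_sum /=.
rewrite [eqbRHS](bigID (mem bsupp)) /= [X in _ + X]big1 ?addr0 => [|C]; last first.
  by rewrite inE negbK => /eqP->; rewrite raddf0.
by apply/eqP/eq_bigr => C _; have [_ _ ->] := idem_factor (bproj_idem C).
Qed.

(** The components have rank at least two and ranks of sum [2 * n], so there
    are exactly [n] of them, of rank two. *)
Lemma card_bsupp : #|bsupp| = n.
Proof.
apply/eqP; rewrite eqn_leq card_bsupp_ge andbT.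
rewrite -(leq_pmul2l (isT : (0 < 2)%N)) -sum_bproj_rank mulnC -sum_nat_const.
by apply: leq_sum => C /bproj_rank.
Qed.

Lemma bproj_rank2 C : C \in bsupp -> \rank (bproj C) = 2.
Proof.
move=> CX; apply/eqP; rewrite eqn_leq bproj_rank // andbT.
have := sum_bproj_rank; rewrite (bigD1 C) //= => e.
have h : (\sum_(D | (D \in bsupp) && (D != C)) 2 <=
    \sum_(D | (D \in bsupp) && (D != C)) \rank (bproj D))%N.
  by apply: leq_sum => D /andP[/bproj_rank].
rewrite sum_nat_const in h.
have c : #|[pred D | (D \in bsupp) && (D != C)]| = n.-1.
  by rewrite -[in RHS]card_bsupp (cardD1 C) CX /=; apply: eq_card => D; rewrite !inE andbC.
have n0 : (0 < n)%N by rewrite -card_bsupp; apply/card_gt0P; exists C.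
by move: h e; rewrite c; move: (\rank _) (\sum_(_ | _) _)%N => a b; lia.
Qed.

Variables a b : 'I_n -> 'M[F]_m.
Hypotheses (aB : forall i S, a i *m B S = B S *m a i)
  (bB : forall i S, b i *m B S = B S *m b i).
Hypotheses (aiso : forall i, (a i)^T *m J *m a i = J)
  (biso : forall i, (b i)^T *m J *m b i = J).
Hypotheses (aa : forall i j, i != j -> a i *m a j = a j *m a i)
  (ab : forall i j, i != j -> a i *m b j = b j *m a i)
  (bb : forall i j, i != j -> b i *m b j = b j *m b i).
Hypothesis nab : forall i, a i *m b i != b i *m a i.

Lemma comm_bproj g C : (forall S, g *m B S = B S *m g) -> g *m bproj C = bproj C *m g.
Proof.
move=> gB; rewrite /bproj -scalemxAl -scalemxAr mulmx_sumr mulmx_suml.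
by congr (_ *: _); apply: eq_bigr => S _; rewrite -scalemxAl -scalemxAr gB.
Qed.

(** Each non-commuting pair is carried by a single plane: on the other ones its
    members act by [1] or [-1], so their squares are trivial there. *)
Lemma pair_plane i : exists p : 'M[F]_m,
  [/\ [/\ p *m p = p, p^T *m J = J *m p & \rank p = 2],
      p *m (a i *m b i) != p *m (b i *m a i),
      a i *m p = p *m a i, b i *m p = p *m b i &
      a i *m a i *m (1%:M - p) = 1%:M - p /\
      b i *m b i *m (1%:M - p) = 1%:M - p].
Proof.
have sigP j : exists C, bproj C *m (a j *m b j) != bproj C *m (b j *m a j).
  apply/existsP; apply: contraNT (nab j); rewrite negb_exists => /forallP h.
  apply/eqP; rewrite -[LHS]mul1mx -[RHS]mul1mx -sum_bproj !mulmx_suml.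
  by apply: eq_bigr => C _; have := h C; rewrite negbK => /eqP.
have [sig hsig] := fin_all_exists sigP.
have sigX j : sig j \in bsupp.
  by rewrite inE; apply: contraNneq (hsig j) => ->; rewrite !mul0mx.
have pa C j := comm_bproj C (aB j).
have pb C j := comm_bproj C (bB j).
have scal j k g : j != k -> (forall S, g *m B S = B S *m g) ->
    g *m a k = a k *m g -> g *m b k = b k *m g ->
    exists c : F, bproj (sig k) *m g = c *: bproj (sig k).
  move=> jk gB ga gb.
  have [e|//] := plane_centralizer (bproj_idem (sig k)) (bproj_rank2 (sigX k))
    (comm_bproj _ gB) (pa _ k) (pb _ k) ga gb.
  by have := hsig k; rewrite e eqxx.
(* on a plane that carries the [k]-th pair, the other pairs act by scalars *)
have sig_inj : injective sig.
  move=> j k ejk; apply/eqP; apply: contraT => jk.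
  have [c hc] := scal j k (a j) jk (aB j) (aa jk) (ab jk).
  have cg x : bproj (sig k) *m x = x *m bproj (sig k) ->
      bproj (sig k) *m (a j *m x) = bproj (sig k) *m (x *m a j).
    move=> hx; rewrite mulmxA hc -scalemxAl hx mulmxA hx -mulmxA hc.
    by rewrite scalemxAr.
  by have := hsig j; rewrite ejk cg ?eqxx // pb.
(* there are [n] pairs and [n] planes *)
have sigK C : C \in bsupp -> exists j, C = sig j.
  move=> CX; have e : sig @: [set: 'I_n] = bsupp.
    apply/eqP; rewrite eqEcard card_imset // cardsT card_ord card_bsupp leqnn andbT.
    by apply/fintype.subsetP => D /imsetP[j _ ->].
  by move: CX; rewrite -e => /imsetP[j _ ->]; exists j.
have sq g : (forall S, g *m B S = B S *m g) -> g^T *m J *m g = J ->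
    (forall k, i != k -> g *m a k = a k *m g) ->
    (forall k, i != k -> g *m b k = b k *m g) ->
    g *m g *m (1%:M - bproj (sig i)) = 1%:M - bproj (sig i).
  move=> gB giso ga gb; rewrite -sum_bproj (bigD1 (sig i)) //= addrC addrK.
  rewrite mulmx_sumr; apply: eq_bigr => C Ci.
  have gp := comm_bproj C gB.
  rewrite -mulmxA gp mulmxA gp -mulmxA.
  have [CX|] := boolP (C \in bsupp); last first.
    by rewrite inE negbK => /eqP->; rewrite mul0mx.
  have [k ek] := sigK _ CX; have ik : i != k by apply: contraNneq Ci => ->; rewrite ek.
  have [c hc] := scal _ _ _ ik gB (ga _ ik) (gb _ ik).
  rewrite -ek in hc.
  exact: (plane_scalar_sq JT Junit (bproj_idem C) (bproj_adj C) (bproj_rank2 CX) gp giso hc).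
exists (bproj (sig i)); split; rewrite ?pa ?pb //.
- by split; [exact: bproj_idem | exact: bproj_adj | exact: bproj_rank2].
split; apply: sq => // k ik; [exact: aa | exact: ab | | exact: bb].
by rewrite -ab // eq_sym.
Qed.

End Characters.

(** * The group of sign changes *)

Section Signs.
Variable n : nat.
Local Notation J := (Jmx n).
Implicit Types (S T : bvec n) (i : 'I_n).

Fact plane_subproof (l : 'I_(2 * n)) : (l./2 < n)%N.
Proof. by rewrite ltn_half_double -mul2n. Qed.

(** The index of the hyperbolic plane that contains a basis vector. *)
Definition plane l : 'I_n := Ordinal (plane_subproof l).

Lemma plane1 i : plane (idx1 i) = i.
Proof. by apply: val_inj => /=; lia. Qed.

Lemma plane2 i : plane (idx2 i) = i.
Proof. by apply: val_inj => /=; lia. Qed.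

Definition epsmx S : 'M[int]_(2 * n) := diag_mx (\row_l (-1) ^+ S (plane l)).

Fact eps_subproof S : symplectic (epsmx S).
Proof.
apply/symplecticP; rewrite tr_diag_mx; apply/matrixP => l j.
rewrite mul_mx_diag mul_diag_mx !mxE.
case: (idxP l) (idxP j) => -[i ->] [] [k ->];
  rewrite ?pair11 ?pair2x ?pair12 ?plane1 ?plane2 ?subr0 ?mulr0 ?mul0r //.
  case: eqP => [->|_]; rewrite ?mulr0 ?mul0r // mulr1.
  by case: (S k); rewrite ?mulr1 // mulrNN mulr1.
case: eqP => [->|_]; rewrite ?sub0r ?oppr0 ?mulr0 ?mul0r //.
by case: (S i); rewrite ?mulr1 ?mul1r // mulrN1 opprK mulN1r.
Qed.

(** The element acting by [(-1) ^ S i] on the [i]-th hyperbolic plane. *)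
Definition eps S : Sp n :=
  exist (fun A : 'M[int]_(2 * n) => symplectic A : Prop) _ (eps_subproof S).

Lemma val_eps S : val (eps S) = epsmx S.
Proof. by []. Qed.

Lemma eps_bxor S T : eps (bxor S T) = (eps S * eps T)%g.
Proof.
apply: val_inj; rewrite val_SpM !val_eps mulmx_diag; congr diag_mx.
by apply/rowP => l; rewrite !mxE ffunE signr_addb.
Qed.

Lemma eps_bzero : eps (bzero n) = 1%g.
Proof.
apply: val_inj; rewrite val_eps val_Sp1 -diag_const_mx; congr diag_mx.
by apply/rowP => l; rewrite !mxE ffunE.
Qed.

Lemma eps_inj : injective eps.
Proof.
move=> S T /(congr1 val); rewrite !val_eps => /matrixP h; apply/ffunP => i.
have := h (idx1 i) (idx1 i); rewrite !mxE eqxx !mulr1n !plane1.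
by case: (S i) (T i) => -[].
Qed.

Lemma eps_ev S i : val (eps S) *m ev i = (-1) ^+ S i *: ev i.
Proof.
rewrite val_eps mul_diag_mx; apply/matrixP => l j; rewrite !mxE.
by case: eqP => [->|_]; rewrite ?plane1 ?mulr0.
Qed.

Lemma eps_fv S i : val (eps S) *m fv i = (-1) ^+ S i *: fv i.
Proof.
rewrite val_eps mul_diag_mx; apply/matrixP => l j; rewrite !mxE.
by case: eqP => [->|_]; rewrite ?plane2 ?mulr0.
Qed.

(** Sign changes commute with the transvections along their eigenvectors. *)
Lemma tv_eps S (v : 'cV[int]_(2 * n)) (c : bool) :
  val (eps S) *m v = (-1) ^+ c *: v -> (tv v * eps S = eps S * tv v)%g.
Proof.
move=> h; have := tv_conj (eps S) v; rewrite h.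
have -> : tv ((-1) ^+ c *: v) = tv v.
  by case: c {h}; rewrite ?scale1r // scaleN1r tvN.
by move/(congr1 (fun g => g * eps S)%g); rewrite mulgVK.
Qed.

Lemma ev_neq0 i : ev i != 0 :> 'cV_(2 * n).
Proof.
by apply/eqP => /colP/(_ (idx1 i)); rewrite !mxE !eqxx.
Qed.

Lemma val_tvX (v : 'cV[int]_(2 * n)) k : val (tv v ^+ k)%g = 1%:M + tens J v v *+ k.
Proof.
elim: k => [|k IH]; first by rewrite expg0 mulr0n addr0.
rewrite expgS val_SpM IH val_tv mulmxDl mul1mx mulmxDr mulmx1.
rewrite raddfMn /= (tens_id2 (JmxT n)) mul0rn addr0 mulrSr.
by rewrite -!addrA.
Qed.

Lemma tv_ev_order i k : (0 < k)%N -> (tv (ev i) ^+ k)%g <> 1%g.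
Proof.
move=> k0 /(congr1 val); rewrite val_tvX val_Sp1 -[RHS]addr0 => /addrI.
rewrite -scaler_nat => /(congr1 (mulmx^~ (fv i))).
rewrite -scalemxAl tensMv omega_ef eqxx scale1r mul0mx => /eqP.
by rewrite scalemx_eq0 (negPf (ev_neq0 i)) orbF pnatr_eq0 -[_ == _]negbK -lt0n k0.
Qed.

(** For [n >= 2], the square of a transvection is the commutator of two
    short-root elements, with which it commutes. *)
Lemma tv_sq_commutator i j : i != j ->
  let x := xv (ev i) (ev j) in let y := xv (ev i) (fv j) in
  let z := (tv (ev i) * tv (ev i))%g in
  [/\ (x * y = y * x * z)%g, (x * z = z * x)%g & (y * z = z * y)%g].
Proof.
move=> ij; have ji : (j == i) = false by rewrite eq_sym (negPf ij).
have [vx vy] : val (xv (ev i) (ev j)) = 1%:M + (tens J (ev i) (ev j) + tens J (ev j) (ev i))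
  /\ val (xv (ev i) (fv j)) = 1%:M + (tens J (ev i) (fv j) + tens J (fv j) (ev i)).
  by rewrite !val_xv ?omegaE ?(negPf ij).
have vz : val (tv (ev i) * tv (ev i))%g = 1%:M + (tens J (ev i) (ev i)) *+ 2.
  by rewrite -(val_tvX (ev i) 2) expgS expg1.
move: (xv _ (ev j)) (xv _ (fv j)) (tv _ * tv _)%g vx vy vz => x y z.
set T := tens J (ev i) (ev i); set A := tens J _ _ + _; set B := tens J _ (fv j) + _.
have [AT TA] : A *m T = 0 /\ T *m A = 0.
  by rewrite !(mulmxDl, mulmxDr) !tensM !omegaE ?(negPf ij) ?ji ?scale0r ?addr0.
have [BT TB] : B *m T = 0 /\ T *m B = 0.
  by rewrite !(mulmxDl, mulmxDr) !tensM !omegaE ?(negPf ij) ?ji ?oppr0 !scale0r !addr0.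
have T2 : T *m T = 0 by exact: tens_id2 (JmxT n) _.
have AB : A *m B = T.
  rewrite !(mulmxDl, mulmxDr) !tensM !omegaE ?(negPf ij) ?eqxx.
  by rewrite !scale0r scale1r !addr0 add0r.
have BA : B *m A = - T.
  rewrite !(mulmxDl, mulmxDr) !tensM !omegaE ?(negPf ij) ?ji ?eqxx.
  by rewrite ?oppr0 !scale0r scaleN1r !addr0 add0r.
move: A B T AT TA BT TB T2 AB BA => A B T AT TA BT TB T2 AB BA vx vy vz; cbv zeta.
split; apply: val_inj; rewrite !val_SpM ?vx ?vy vz !(mulmxDl, mulmxDr, mul1mx, mulmx1).
all: rewrite ?AB ?BA ?AT ?TA ?BT ?TB ?mulNmx ?T2 ?oppr0 ?addr0.
- by apply/matrixP => k l; rewrite !mxE; ring.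
- by apply/matrixP => k l; rewrite !mxE; ring.
by apply/matrixP => k l; rewrite !mxE; ring.
Qed.

End Signs.

(** * Images of transvections under a faithful symplectic representation *)

Section Representation.
Variables (n : nat) (Phi : Sp n -> 'M[rat]_(2 * n)).
Local Notation J := (Jmx n).
(** The matrix of the symplectic form over the rationals. *)
Definition JQ : 'M[rat]_(2 * n) := map_mx intr J.
Hypotheses (PhiM : forall g h, Phi (g * h)%g = Phi g *m Phi h)
  (Phi1 : Phi 1%g = 1%:M) (Phi_inj : injective Phi)
  (Phi_iso : forall g, (Phi g)^T *m JQ *m Phi g = JQ).
Implicit Types (g h : Sp n) (i j : 'I_n) (u v : 'cV[int]_(2 * n)).

Lemma JQT : JQ^T = - JQ.
Proof. by rewrite /JQ map_trmx JmxT map_mxN. Qed.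

Lemma JQ_unit : JQ \in unitmx.
Proof. by rewrite unitmxE det_map_mx rmorph_unit // -unitmxE Jmx_unit. Qed.

Lemma PhiV g : Phi g^-1%g *m Phi g = 1%:M.
Proof. by rewrite -PhiM mulVg. Qed.

Lemma PhiMV g : Phi g *m Phi g^-1%g = 1%:M.
Proof. by rewrite -PhiM mulgV. Qed.

Lemma Phi_comm g h : (g * h = h * g)%g -> Phi g *m Phi h = Phi h *m Phi g.
Proof. by rewrite -!PhiM => ->. Qed.

(** The transvections along [ev i] and [fv i] are represented on a plane, the
    image of [U *m W], up to involutions on its complement. *)
Lemma rep_plane i : exists (U : 'M[rat]_(2 * n, 2)) (W : 'M[rat]_(2, 2 * n)),
  let p := U *m W in let a := Phi (tv (ev i)) in let b := Phi (tv (fv i)) in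
  [/\ [/\ W *m U = 1%:M, p *m p = p, p^T *m JQ = JQ *m p & \rank p = 2],
      p *m (a *m b) != p *m (b *m a),
      a *m p = p *m a, b *m p = p *m b
    & a *m a *m (1%:M - p) = 1%:M - p /\ b *m b *m (1%:M - p) = 1%:M - p].
Proof.
have om0 (x y : 'cV[int]_(2 * n)) : omega J x y = 0 ->
    Phi (tv x) *m Phi (tv y) = Phi (tv y) *m Phi (tv x).
  by move=> h; apply: Phi_comm; apply: tv_comm.
have [] := @pair_plane n rat _ JQ JQT JQ_unit erefl (fun S => Phi (eps S)) _ _ _ _
  (fun i => Phi (tv (ev i))) (fun i => Phi (tv (fv i))) _ _ _ _ _ _ _ _ i.
- by move=> S T; rewrite eps_bxor PhiM.
- by rewrite eps_bzero Phi1.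
- by move=> S T /Phi_inj/eps_inj.
- by move=> S; apply: Phi_iso.
- by move=> k S; apply/Phi_comm/(tv_eps (eps_ev S k)).
- by move=> k S; apply/Phi_comm/(tv_eps (eps_fv S k)).
- by move=> k; apply: Phi_iso.
- by move=> k; apply: Phi_iso.
- by move=> k l kl; apply: om0; rewrite omegaE.
- by move=> k l kl; apply: om0; rewrite omegaE (negPf kl).
- by move=> k l kl; apply: om0; rewrite omegaE.
- move=> k; rewrite -!PhiM (inj_eq Phi_inj) tv_ncomm //.
  by rewrite omegaE eqxx oner_neq0.
move=> p [[pp pJ p2] hn ha hb hc]; have [U [W [uw wu]]] := plane_factor pp p2.
by exists U, W; rewrite /= uw.
Qed.

(** [Phi (tv v) ^+ 2 = 1 + 2 * Nil v]. Once [Nil v] is known to square to zero,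
    it is the logarithm of the image of the transvection, up to a sign that
    squaring removes. *)
Definition Nil v : 'M[rat]_(2 * n) := 2^-1 *: (Phi (tv v) *m Phi (tv v) - 1%:M).

Lemma Nil_act g v : Nil (val g *m v) = Phi g *m Nil v *m Phi g^-1%g.
Proof.
rewrite /Nil -tv_conj !PhiM -scalemxAr -scalemxAl mulmxBr mulmxBl mulmx1 PhiMV.
by rewrite -!mulmxA (mulmxA (Phi g^-1%g)) PhiV mul1mx.
Qed.

Lemma Nil_comm u v : omega J u v = 0 -> Nil u *m Nil v = Nil v *m Nil u.
Proof.
move=> h; have e : Phi (tv u) *m Phi (tv v) = Phi (tv v) *m Phi (tv u).
  by apply: Phi_comm; apply: tv_comm.
rewrite /Nil -!scalemxAl -!scalemxAr; do 2!congr (_ *: _).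
have e2 : Phi (tv u) *m Phi (tv u) *m (Phi (tv v) *m Phi (tv v)) =
    Phi (tv v) *m Phi (tv v) *m (Phi (tv u) *m Phi (tv u)).
  by rewrite -!mulmxA (mulmxA _ (Phi (tv v))) e -(mulmxA _ (Phi (tv u))) e !mulmxA e
     -(mulmxA _ (Phi (tv u))) e !mulmxA.
rewrite !mulmxBl !mulmxBr !mul1mx !mulmx1 e2.
by move: (_ *m _) (_ *m _) (_ *m _) => A B C; apply/matrixP => k l; rewrite !mxE; ring.
Qed.

(** The square of the image of the transvection along [ev i] has the trace of a
    unipotent matrix. *)
Definition trace_cond i :=
  \tr (Phi (tv (ev i)) *m Phi (tv (ev i))) = (2 * n)%:R.

(** The nilpotent parts of a hyperbolic pair. *)
Lemma Nil_pair i : trace_cond i ->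
  [/\ Nil (ev i) *m Nil (ev i) = 0, \rank (Nil (ev i)) = 1%N
    & \tr (Nil (ev i) *m Nil (fv i)) = -1].
Proof.
have [U [W]] := rep_plane i.
set p := U *m W; set a := Phi _; set b := Phi _.
move=> [[wu pp pJ p2] hn ha hb [a2 b2]] tc.
pose rho (g : 'M[rat]_(2 * n)) := W *m g *m U.
have rhoM x y : x *m p = p *m x -> rho (x *m y) = rho x *m rho y.
  move=> hx; rewrite /rho; have -> : W *m x *m U *m (W *m y *m U) = W *m (x *m p) *m y *m U.
    by rewrite /p !mulmxA.
  by rewrite hx /p !mulmxA wu mul1mx.
have pE x : x *m p = p *m x -> p *m x = U *m rho x *m W.
  move=> hx; rewrite /rho; have -> : U *m (W *m x *m U) *m W = p *m (x *m p).
    by rewrite /p !mulmxA.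
  by rewrite hx mulmxA pp.
set Y := rho a; set Z := rho b.
have hab : (a *m b) *m p = p *m (a *m b) by rewrite -mulmxA hb mulmxA ha mulmxA.
have hba : (b *m a) *m p = p *m (b *m a) by rewrite -mulmxA ha mulmxA hb mulmxA.
have CH (g : 'M[rat]_(2 * n)) : g *m p = p *m g -> g^T *m JQ *m g = JQ ->
    rho g *m rho g = \tr (rho g) *: rho g - 1%:M.
  move=> gp gJ; exact: (plane_CH JQT JQ_unit pp pJ p2 erefl wu gp gJ).
have cY := CH _ ha (Phi_iso _); have cZ := CH _ hb (Phi_iso _).
rewrite -/Y -/Z in cY cZ.
have cYZ : (Y *m Z) *m (Y *m Z) = \tr (Y *m Z) *: (Y *m Z) - 1%:M.
  rewrite -rhoM //; apply: CH => //; rewrite /a /b -PhiM; exact: Phi_iso.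
have YZ : Y *m Z != Z *m Y.
  apply: contra hn => /eqP e; rewrite (pE _ hab) (pE _ hba) !rhoM //.
  by rewrite -/Y -/Z e.
have br : Y *m Z *m Y = Z *m Y *m Z.
  rewrite -!rhoM //; congr rho; rewrite /a /b -!PhiM.
  by rewrite tv_braid // omegaE eqxx expr1n.
have sqE (x : 'M[rat]_(2 * n)) : x *m p = p *m x -> x *m x *m (1%:M - p) = 1%:M - p ->
    x *m x = U *m (rho x *m rho x) *m W + (1%:M - p).
  move=> hx x2; have hxx : x *m x *m p = p *m (x *m x) by rewrite -mulmxA hx mulmxA hx mulmxA.
  transitivity (x *m x *m p + x *m x *m (1%:M - p)).
    by rewrite -mulmxDr addrC subrK mulmx1.
  by rewrite x2 hxx (pE _ hxx) (rhoM _ _ hx).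
have nilE (x : 'M[rat]_(2 * n)) : x *m p = p *m x -> x *m x *m (1%:M - p) = 1%:M - p ->
    2^-1 *: (x *m x - 1%:M) = U *m (2^-1 *: (rho x *m rho x - 1%:M)) *m W.
  move=> hx x2; rewrite (sqE x hx x2) -scalemxAr -scalemxAl; congr (_ *: _).
  by rewrite mulmxBr mulmxBl mulmx1 -/p -addrA addrAC subrr sub0r.
have trU (A : 'M[rat]_2) : \tr (U *m A *m W) = \tr A.
  by rewrite -(mulmxA U) mxtrace_mulC -(mulmxA A) wu mulmx1.
have tYY : \tr (Y *m Y) = 2.
  move: tc; rewrite /trace_cond -/a (sqE a ha a2) -/Y raddfD /= raddfB /= mxtrace1.
  rewrite trU /p (mxtrace_mulC U) wu mxtrace1.
  by move/eqP; rewrite addrCA -subr_eq0 addrAC subrr add0r subr_eq0 => /eqP.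
have [M2 M0 tMM] := mx2_braid_nil cY cZ cYZ (elimN eqP YZ) br tYY.
rewrite /Nil -/a -/b (nilE a ha a2) (nilE b hb b2) -/Y -/Z.
move: M2 M0 tMM; set M := _ *: _; set M' := _ *: _ => M2 M0 tMM.
have UMW (A B : 'M[rat]_2) : U *m A *m W *m (U *m B *m W) = U *m (A *m B) *m W.
  by rewrite -!mulmxA (mulmxA W U) wu mul1mx.
split.
- by rewrite UMW M2 mulmx0 mul0mx.
- apply/eqP; rewrite eqn_leq; apply/andP; split; last first.
    rewrite lt0n mxrank_eq0; apply/eqP => e; apply: M0.
    have -> : M = W *m (U *m M *m W) *m U.
      by rewrite !mulmxA wu mul1mx -mulmxA wu mulmx1.
    by rewrite e mulmx0 mul0mx.
  apply: (leq_trans (mxrankM_maxl _ _)); apply: (leq_trans (mxrankM_maxr _ _)).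
  rewrite -ltnS ltn_neqAle rank_leq_row andbT; apply/eqP => r2; apply: M0.
  apply: (@row_free_inj _ _ _ _ M); first by rewrite /row_free r2.
  by rewrite M2 mul0mx.
by rewrite UMW trU.
Qed.

(** [Phi (tv v) ^+ 2 = 1 + 2 Nil v] is an isometry, so [Nil v] is an
    infinitesimal one. *)
Lemma Nil_adj v : Nil v *m Nil v = 0 -> (Nil v)^T *m JQ = - (JQ *m Nil v).
Proof.
pose A := Phi (tv v * tv v)%g.
have : A = 1%:M + 2 *: Nil v.
  rewrite /A PhiM /Nil scalerA mulfV ?pnatr_eq0 // scale1r.
  by rewrite addrC subrK.
move: (Nil v) => N eA N2.
have A1 : A *m (1%:M - 2 *: N) = 1%:M.
  rewrite eA mulmxDl !mulmxBr !mul1mx !mulmx1.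
  rewrite -!scalemxAl -!scalemxAr ?mulmx1.
  rewrite N2.
  by rewrite !scaler0 subr0 subrK.
have e : A^T *m JQ = JQ *m (1%:M - 2 *: N).
  transitivity (A^T *m JQ *m (A *m (1%:M - 2 *: N))); first by rewrite A1 mulmx1.
  by rewrite mulmxA Phi_iso.
move: e; rewrite eA linearD /= trmx1 mulmxDl mulmxBr mul1mx mulmx1 => /addrI.
rewrite linearZ /= -scalemxAl -scalemxAr -scalerN => /(congr1 (GRing.scale 2^-1)).
by rewrite !scalerA mulVf ?pnatr_eq0 // !scale1r.
Qed.

Lemma Nil_tens i : trace_cond i -> exists (k : rat) (x : 'cV[rat]_(2 * n)),
  [/\ k != 0, x != 0 & Nil (ev i) = k *: tens JQ x x].
Proof.
move=> /Nil_pair[N2 r1 _].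
by apply: (rank1_tens JQT JQ_unit _ r1); apply: Nil_adj.
Qed.

(** If the square [E] of the image of a transvection were not unipotent on its
    plane, the short-root elements of which [E] is the commutator would
    preserve this plane, because they commute with [E]. On the plane, either
    they commute, and [E] is trivial, or [E] is scalar, and its square is
    trivial; but a transvection has infinite order. *)
Lemma trace_cond_gt1 i j : i != j -> trace_cond i.
Proof.
move=> ij; have [U [W]] := rep_plane i.
have [p ep] : exists p, p = U *m W by eexists.
rewrite -ep /=; set a := Phi _; set b := Phi _.
move=> [[wu pp pJ p2] hn ha hb [a2 b2]].
have [rl rx ry] := tv_sq_commutator ij.
set x := xv _ _ in rl rx ry; set y := xv _ (fv j) in rl rx ry.
pose E := a *m a; have eE : E = Phi (tv (ev i) * tv (ev i))%g by rewrite PhiM.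
have Ep : E *m p = p *m E by rewrite /E -mulmxA ha mulmxA ha mulmxA.
have Eiso : E^T *m JQ *m E = JQ by rewrite eE Phi_iso.
have xE : Phi x *m E = E *m Phi x by rewrite eE -!PhiM rx.
have yE : Phi y *m E = E *m Phi y by rewrite eE -!PhiM ry.
have E1 : E *m (1%:M - p) = 1%:M - p by [].
pose e := W *m E *m U; have CH := plane_CH JQT JQ_unit pp pJ p2 (esym ep) wu Ep Eiso.
rewrite -/e in CH.
have pE1 : E *m p = U *m e *m W.
  have -> : U *m e *m W = p *m (E *m p) by rewrite /e ep !mulmxA.
  by rewrite Ep mulmxA pp.
have pE2 : E *m E *m p = \tr e *: (E *m p) - p.
  have -> : E *m E *m p = U *m (e *m e) *m W.
    have -> : U *m (e *m e) *m W = (U *m e *m W) *m (U *m e *m W).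
      by rewrite !mulmxA -(mulmxA _ W U) wu mulmx1.
    by rewrite -pE1 -[RHS]mulmxA (mulmxA p E p) -Ep -(mulmxA E p p) pp mulmxA.
  by rewrite CH mulmxBr mulmxBl mulmx1 -scalemxAr -scalemxAl pE1 ep.
have E0 k : (0 < k)%N -> Phi (tv (ev i) ^+ k)%g <> 1%:M.
  by move=> k0; rewrite -Phi1 => /Phi_inj; apply: tv_ev_order.
have [te|te] := eqVneq (\tr e) 2.
  rewrite /trace_cond -/a -/E.
  have -> : E = U *m e *m W + (1%:M - p).
    by rewrite -pE1 -a2 -mulmxDr addrC subrK mulmx1.
  rewrite raddfD /= raddfB /= mxtrace1 -(mulmxA U) mxtrace_mulC -(mulmxA e) wu mulmx1.
  by rewrite te ep mxtrace_mulC wu mxtrace1 addrC subrK.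
have Xp := comm_nonunipotent pp Ep a2 pE2 te xE.
have Yp := comm_nonunipotent pp Ep a2 pE2 te yE.
case: (plane_centralizer pp p2 Ep Xp Yp (esym xE) (esym yE)) => [h|[c hc]].
  case: (E0 2) => //; rewrite expgS expg1 -eE.
  have pEp : p *m E = p.
    have hq : Phi (y * x)%g *m (p *m E) = Phi (y * x)%g *m p.
      have qp : Phi (y * x)%g *m p = p *m Phi (y * x)%g.
        by rewrite (PhiM y x) -mulmxA Xp (mulmxA (Phi y) p) Yp -mulmxA.
      by rewrite mulmxA qp -mulmxA eE -PhiM -rl (PhiM x y) (PhiM y x).
    by rewrite -[LHS]mul1mx -(PhiV (y * x)%g) -mulmxA hq mulmxA PhiV mul1mx.
  have e2 : E = E *m p + E *m (1%:M - p).
    by rewrite -mulmxDr addrC subrK mulmx1.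
  by rewrite e2 Ep pEp E1 addrC subrK.
case: (E0 4) => //; rewrite (expgnDr _ 2 2) PhiM expgS expg1 -eE.
have e4 : E *m E = E *m E *m p + E *m E *m (1%:M - p).
  by rewrite -mulmxDr addrC subrK mulmx1.
rewrite e4 -!(mulmxA E E) !E1 Ep mulmxA Ep -mulmxA.
by rewrite
  (plane_scalar_sq JQT JQ_unit pp pJ p2 Ep Eiso hc) addrC subrK.
Qed.

End Representation.

(** * The case of SL_2(Z) *)

Section SixWords.
Variables (R : comNzRingType) (k : nat) (A B : 'M[R]_k).
Hypotheses (A2 : A *m A = - 1%:M) (B2 : B *m B = - 1%:M)
  (br : A *m B *m A = B *m A *m B).
Implicit Type M : 'M[R]_k.

(** Modulo signs, two braiding elements of order two generate a group with at
    most six elements, which [six] lists. *)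
Inductive six : 'M[R]_k -> Prop :=
  | Six1 : six 1%:M | SixA : six A | SixB : six B
  | SixAB : six (A *m B) | SixBA : six (B *m A) | SixABA : six (A *m B *m A).

Definition pm_six M := six M \/ six (- M).

Lemma pm_sixN M : pm_six M -> pm_six (- M).
Proof. by rewrite /pm_six opprK => -[]; [right | left]. Qed.

Lemma pm_six_mulA M : pm_six M -> pm_six (A *m M).
Proof.
have key N : six N -> pm_six (A *m N).
  case; rewrite ?mulmx1 ?mulmxA ?A2 ?mulNmx ?mul1mx.
  - by left; apply: SixA.
  - by right; rewrite opprK; apply: Six1.
  - by left; apply: SixAB.
  - by right; rewrite opprK; apply: SixB.
  - by left; apply: SixABA.
  - by right; rewrite opprK; apply: SixBA.
by case=> [/key//|/key/pm_sixN]; rewrite mulmxN opprK.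
Qed.

Lemma pm_six_mulB M : pm_six M -> pm_six (B *m M).
Proof.
have key N : six N -> pm_six (B *m N).
  case; rewrite ?mulmx1 ?mulmxA ?B2 -?br ?mulNmx ?mul1mx.
  - by left; apply: SixB.
  - by left; apply: SixBA.
  - by right; rewrite opprK; apply: Six1.
  - by left; apply: SixABA.
  - by right; rewrite opprK; apply: SixA.
  - right; rewrite -mulmxA A2 mulmxN mulmx1 opprK; exact: SixAB.
by case=> [/key//|/key/pm_sixN]; rewrite mulmxN opprK.
Qed.

Lemma ABBA : (A *m B) *m (B *m A) = 1%:M.
Proof. by rewrite -mulmxA (mulmxA B) B2 mulNmx mul1mx mulmxN A2 opprK. Qed.

Lemma BAAB : (B *m A) *m (A *m B) = 1%:M.
Proof. by rewrite -mulmxA (mulmxA A) A2 mulNmx mul1mx mulmxN B2 opprK. Qed.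

(** Up to a scalar of square one, the elements of the subgroup of order
    three: it is commutative and contains all squares. *)
Definition pm_three M :=
  exists2 c : R, c * c = 1 & [\/ M = c%:M, M = c *: (A *m B) | M = c *: (B *m A)].

Lemma pm_six_sq M : pm_six M -> pm_three (M *m M).
Proof.
have key N : six N -> pm_three (N *m N).
  have n1 : -1 * -1 = 1 :> R by rewrite mulrNN mulr1.
  case.
  - by exists 1; rewrite ?mulr1 // mulmx1; constructor 1.
  - by exists (-1) => //; rewrite A2 raddfN; constructor 1.
  - by exists (-1) => //; rewrite B2 raddfN; constructor 1.
  - exists (-1) => //; constructor 3.
    by rewrite -mulmxA (mulmxA B A B) -br !mulmxA A2 !mulNmx mul1mx scaleN1r.
  - exists (-1) => //; constructor 2.
    by rewrite mulmxA -br -mulmxA A2 mulmxN mulmx1 scaleN1r.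
  exists (-1) => //; constructor 1.
  have -> : A *m B *m A *m (A *m B *m A) = (A *m B) *m (A *m A) *m (B *m A).
    by rewrite !mulmxA.
  by rewrite A2 mulmxN mulmx1 mulNmx ABBA raddfN.
by case=> /key //; rewrite mulNmx mulmxN opprK.
Qed.

Lemma pm_three_comm M N : pm_three M -> pm_three N -> M *m N = N *m M.
Proof.
case=> c _ hM [d _ hN]; case: hM hN => -> [] ->;
  rewrite ?mul_scalar_mx ?mul_mx_scalar ?scalar_mxC // -?scalemxAl -?scalemxAr
    ?scalerA ?(mulrC d c) ?ABBA ?BAAB //.
by rewrite !scale_scalar_mx mulrC.
Qed.

Lemma AB3 : (A *m B) *m (A *m B) *m (A *m B) = - 1%:M.
Proof.
rewrite -[in X in X *m _]mulmxA (mulmxA B A B) -br !mulmxA A2 !mulNmx mul1mx.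
by rewrite -(mulmxA B A A) A2 mulmxN mulmx1 mulNmx opprK B2.
Qed.

Lemma BA3 : (B *m A) *m (B *m A) *m (B *m A) = - 1%:M.
Proof.
rewrite (mulmxA (B *m A) B A) -br -(mulmxA _ A A) A2 mulmxN mulmx1 mulNmx ABBA.
by [].
Qed.

Lemma pm_three_cube M : pm_three M -> exists c : R, M *m M *m M = c%:M.
Proof.
case=> c c2 [] ->.
- by exists (c * c * c); rewrite -!scalar_mxM.
- exists (- (c * c * c)); rewrite -!scalemxAl -!scalemxAr -!scalemxAl AB3.
  by rewrite !scalerA scalerN scalemx1 mulrA -scaleN1r scale_scalar_mx mulN1r.
exists (- (c * c * c)); rewrite -!scalemxAl -!scalemxAr -!scalemxAl BA3.
by rewrite !scalerA scalerN scalemx1 mulrA -scaleN1r scale_scalar_mx mulN1r.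
Qed.

End SixWords.

Section SL2.
Implicit Types g h : Sp 1.
Local Notation e0 := (ev (ord0 : 'I_1)).
Local Notation f0 := (fv (ord0 : 'I_1)).
Local Notation a := (tv e0).
Local Notation b := (tv f0).

(** The underlying two-by-two matrix. *)
Definition mx1 g : 'M[int]_2 := val g.

Lemma mx1M g h : mx1 (g * h)%g = mx1 g *m mx1 h.
Proof. by []. Qed.

Lemma idx1_ord0 : idx1 (ord0 : 'I_1) = 0 :> 'I_2.
Proof. exact: val_inj. Qed.

Lemma idx2_ord0 : idx2 (ord0 : 'I_1) = 1 :> 'I_2.
Proof. exact: val_inj. Qed.

Lemma mx1_det g : mx1 g 0 0 * mx1 g 1 1 - mx1 g 0 1 * mx1 g 1 0 = 1.
Proof.
have := symplectic_formE (val g) (idx1 ord0) (idx2 ord0).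
rewrite Sp_isometry mxE pair12 pair2x eqxx subr0 /symplectic_form big_ord1.
by rewrite idx1_ord0 idx2_ord0.
Qed.

Lemma mx1_CH g : mx1 g *m mx1 g = \tr (mx1 g) *: mx1 g - 1%:M.
Proof. exact: mx2_CH (mx1_det g). Qed.

Lemma tens_delta n (l i j : 'I_(2 * n)) :
  tens (Jmx n) (delta_mx l 0) (delta_mx l 0) i j = (i == l)%:R * Jmx n l j.
Proof. by rewrite /tens -mulmxA trmx_delta -rowE mxE big_ord1 !mxE eqxx andbT. Qed.

Lemma transv_entry n (l i j : 'I_(2 * n)) (z : int) :
  (1%:M + z *: tens (Jmx n) (delta_mx l 0) (delta_mx l 0)) i j =
  (i == j)%:R + z * ((i == l)%:R * Jmx n l j).
Proof. by rewrite -tens_delta [LHS]mxE [X in _ + X]mxE [X in X + _]mxE. Qed.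

Lemma Jmx1E : [/\ Jmx 1 (0 : 'I_2) (0 : 'I_2) = 0, Jmx 1 (0 : 'I_2) (1 : 'I_2) = 1,
  Jmx 1 (1 : 'I_2) (0 : 'I_2) = -1 & Jmx 1 (1 : 'I_2) (1 : 'I_2) = 0].
Proof.
by rewrite -idx1_ord0 -idx2_ord0; split; rewrite mxE ?pair11 ?pair12 ?pair2x.
Qed.

(** Powers of the two generating transvections. *)
Lemma mx1_aX (z : int) : 1%:M + z *: tens (Jmx 1) e0 e0 =
  \matrix_(i < 2, j < 2) (if (i == 0) && (j == 1) then z else (i == j)%:R).
Proof.
have [J0 J1 J2 J3] := Jmx1E.
have E (i j : 'I_2) := @transv_entry 1 (idx1 ord0) i j z.
apply: (@mx2P _ (1%:M + z *: tens (Jmx 1) e0 e0)).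
all: rewrite E idx1_ord0 ?J0 ?J1 ?J2 ?J3 mxE /= ?mulr0 ?mulr1 ?addr0 ?add0r //.
all: by rewrite ?mul0r ?mulr0 ?mul1r ?mulr1 ?mulrN1 ?addr0 ?add0r.
Qed.

Lemma mx1_bX (z : int) : 1%:M + z *: tens (Jmx 1) f0 f0 =
  \matrix_(i < 2, j < 2) (if (i == 1) && (j == 0) then - z else (i == j)%:R).
Proof.
have [J0 J1 J2 J3] := Jmx1E.
have E (i j : 'I_2) := @transv_entry 1 (idx2 ord0) i j z.
apply: (@mx2P _ (1%:M + z *: tens (Jmx 1) f0 f0)).
all: rewrite E idx2_ord0 ?J0 ?J1 ?J2 ?J3 mxE /= ?mulr0 ?mulr1 ?addr0 ?add0r //.
all: by rewrite ?mul0r ?mulr0 ?mul1r ?mulr1 ?mulrN1 ?addr0 ?add0r.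
Qed.

(** SL_2(Z) is generated by its two elementary transvections: after moving the
    image of the first basis vector back, a power of [a] is left. *)
Lemma Sp1_gen (K : Sp 1 -> Prop) : K 1%g ->
  (forall g h, K g -> K h -> K (g * h)%g) -> (forall g, K g -> K g^-1%g) ->
  K a -> K b -> forall g, K g.
Proof.
move=> K1 KM KV Ka Kb g.
have ord1' (i : 'I_1) : i = ord0 by rewrite ord1.
have [h Kh hh] : reach ord0 K (val g *m bv false ord0).
  by apply: reach_orbit => // i; rewrite (ord1' i).
rewrite -(mulVKg h g); apply: (KM _ _) => //.
have ke : val (h^-1 * g)%g *m e0 = e0.
  by rewrite val_SpM -mulmxA -[val g *m _]/(val g *m bv false ord0) -hh mul_SpVK.
move: (h^-1 * g)%g ke => k ke {h Kh hh g}.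
have k0 (i : 'I_2) : mx1 k i 0 = (i == 0)%:R.
  move/colP/(_ i): ke; rewrite /ev idx1_ord0 -colE !mxE eqxx andbT.
  by [].
have k11 : mx1 k 1 1 = 1.
  by have := mx1_det k; rewrite !k0 /= mul1r mulr0 subr0.
have vk : val k = 1%:M + mx1 k 0 1 *: tens (Jmx 1) e0 e0.
  rewrite mx1_aX; apply: (@mx2P _ (mx1 k)); rewrite !mxE /= ?k0 ?k11 //.
have KX j : K (a ^+ j)%g.
  by elim: j => [|j IH]; rewrite ?expg0 // expgS; apply: (KM _ _).
case: (mx1 k 0 1) vk => j vk.
  have -> : k = (a ^+ j)%g by apply: val_inj; rewrite vk val_tvX -scaler_nat natz.
  exact: KX.
have -> : k = ((a ^+ j.+1)^-1)%g; last exact/KV/KX.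
apply: val_inj; rewrite (val_expM _ (val_tvX _ _)); last first.
  by rewrite -scaler_nat -scalemxAl -scalemxAr (tens_id2 (JmxT 1)) !scaler0.
by rewrite vk NegzE scaleNr -scaler_nat natz.
Qed.

End SL2.

(** A map between groups that preserves products preserves the unit. *)
Lemma multiplicative1 (G H : groupType) (f : {multiplicative G -> H}) : f 1%g = 1%g.
Proof. by apply: (mulgI (f 1%g)); rewrite -gmulfM !mulg1. Qed.

Section SL2Automorphism.
Variable phi : {multiplicative Sp 1 -> Sp 1}.
Hypothesis phi_bij : bijective phi.
Implicit Types g h : Sp 1.
Local Notation a := (tv (ev (ord0 : 'I_1))).
Local Notation b := (tv (fv (ord0 : 'I_1))).
Local Notation A := (mx1 (phi a)).
Local Notation B := (mx1 (phi b)).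

Lemma braid_ab : (a * b * a = b * a * b)%g.
Proof. by apply: tv_braid; rewrite omegaE eqxx expr1n. Qed.

Lemma mxtrace_B : \tr B = \tr A.
Proof.
have -> : b = (a * b * a * (a * b)^-1)%g by rewrite braid_ab -(mulgA b a b) mulgK.
move: (a * b)%g => c; rewrite gmulfM mx1M mxtrace_mulC -mx1M -gmulfM.
by rewrite mulKg.
Qed.

Section Modulo.
Variable R : comNzRingType.
Hypothesis tA0 : (\tr A)%:~R = 0 :> R.
(** The matrix of [phi g] over a ring where the trace of [phi a] vanishes. *)
Let red g : 'M[R]_2 := map_mx intr (mx1 (phi g)).

Lemma redM g h : red (g * h)%g = red g *m red h.
Proof. by rewrite /red gmulfM mx1M map_mxM. Qed.

Lemma red1 : red 1%g = 1%:M.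
Proof. by rewrite /red multiplicative1 -[mx1 1%g]/(1%:M) map_mx1. Qed.

Lemma red_sq g : (\tr (mx1 (phi g)))%:~R = 0 :> R -> red g *m red g = - 1%:M.
Proof.
move=> t0; rewrite /red -map_mxM mx1_CH map_mxB map_mxZ map_mx1.
by rewrite /= t0 scale0r sub0r.
Qed.

Lemma redA2 : red a *m red a = - 1%:M.
Proof. exact: red_sq. Qed.

Lemma redB2 : red b *m red b = - 1%:M.
Proof. by apply: red_sq; rewrite mxtrace_B. Qed.

Lemma red_braid : red a *m red b *m red a = red b *m red a *m red b.
Proof. by rewrite -!redM braid_ab. Qed.

Lemma red_six g : pm_six (red a) (red b) (red g).
Proof.
pose S := pm_six (red a) (red b).
pose K g := (forall M, S M -> S (red g *m M)) /\ (forall M, S M -> S (red g^-1%g *m M)).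
have inv h : red h *m red h = - 1%:M -> red h^-1%g = - red h.
  move=> h2; rewrite -[LHS]opprK -[X in - X]mul1mx -mulNmx -h2 mulmxN.
  by rewrite -mulmxA -redM mulgV red1 mulmx1.
have [] : K g; last by move=> /(_ _ (or_introl (Six1 _ _))); rewrite mulmx1.
apply: Sp1_gen.
- by split=> M; rewrite ?invg1 red1 mul1mx.
- move=> g1 g2 [h1 h2] [h3 h4]; split=> M SM.
    by rewrite redM -mulmxA; apply/h1/h3.
  by rewrite invgM redM -mulmxA; apply/h4/h2.
- by move=> g1 [h1 h2]; split=> //; rewrite invgK.
- split=> M SM; first exact: pm_six_mulA redA2 _ SM.
  by rewrite (inv _ redA2) mulNmx; apply/pm_sixN/(pm_six_mulA redA2 SM).
split=> M SM; first exact: pm_six_mulB redA2 redB2 red_braid _ SM.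
by rewrite (inv _ redB2) mulNmx; apply/pm_sixN/(pm_six_mulB redA2 redB2 red_braid SM).
Qed.

(** As [phi] is onto, the reductions of [a] and [b] themselves obey the laws of
    that group: the squares commute, which gives [4 = 0], and the sixth power
    of [a] is scalar, which gives [6 = 0]. *)
Lemma mod_trace_two : 2 = 0 :> R.
Proof.
have [psi phiK psiK] := phi_bij.
have redE h : red (psi h) = map_mx intr (mx1 h) by rewrite /red psiK.
have three h : pm_three (red a) (red b) (map_mx intr (mx1 h *m mx1 h)).
  rewrite map_mxM -redE; apply: (pm_six_sq redA2 redB2 red_braid); exact: red_six.
have aE k : mx1 (a ^+ k)%g = \matrix_(i < 2, j < 2)
    (if (i == 0) && (j == 1) then k%:Z else (i == j)%:R).
  by rewrite -mx1_aX /mx1 val_tvX -scaler_nat natz.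
have bE k : mx1 (b ^+ k)%g = \matrix_(i < 2, j < 2)
    (if (i == 1) && (j == 0) then - k%:Z else (i == j)%:R).
  by rewrite -mx1_bX /mx1 val_tvX -scaler_nat natz.
have four : 4 = 0 :> R.
  have /matrixP/(_ 0 0) := pm_three_comm redA2 redB2 (three a) (three b).
  rewrite -!mx1M -!(expgS _ 1) -!map_mxM aE bE mxE [RHS]mxE.
  rewrite !mulmx2E !mxE /= => h.
  have -> : 4 = 1%:~R - (-3)%:~R :> R by ring.
  by rewrite -[(-3)%:~R]/((1 * 1 + 2%Z * - 2%Z)%:~R) h subrr.
have six : 6 = 0 :> R.
  have [c] := pm_three_cube redA2 redB2 red_braid (three a).
  rewrite -!map_mxM -!mx1M => /matrixP/(_ 0 1).
  have -> : (a * a * (a * a) * (a * a) = a ^+ 6)%g by rewrite !expgS expg0 mulg1 !mulgA.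
  rewrite aE !mxE /= => h; have -> : 6 = 6%Z%:~R :> R by [].
  by rewrite h.
have -> : 2 = 6 - 4 :> R by ring.
by rewrite six four subrr.
Qed.

End Modulo.

(** The trace of [phi a] divides two by the previous lemma; the values [0], [1]
    and [-1] are those of matrices of finite order. *)
Lemma trace_sq4 : \tr A * \tr A = 4.
Proof.
set t := \tr A; have CH : A *m A = t *: A - 1%:M := mx1_CH _.
have fin k : (0 < k)%N -> mx1 (phi (a ^+ k))%g <> 1%:M.
  move=> k0 e; apply: (@tv_ev_order 1 ord0 k k0).
  by apply: (bij_inj phi_bij); rewrite multiplicative1; apply: val_inj.
have [t0|t0] := eqVneq t 0.
  case: (fin 4) => //; rewrite (expgnDr _ 2 2) gmulfM mx1M expgS expg1 gmulfM mx1M.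
  by rewrite CH t0 scale0r sub0r mulmxN mulNmx mulmx1 opprK.
have [t1|t1] := eqVneq (t * t) 1.
  case: (fin 6) => //; rewrite (expgnDr _ 3 3) gmulfM mx1M !expgS expg0 mulg1 !gmulfM !mx1M.
  have e3 : A *m (A *m A) = - t *: 1%:M.
    rewrite CH mulmxBr mulmx1 -scalemxAr CH scalerBr scalerA t1 scale1r.
    by rewrite addrAC subrr sub0r scaleNr.
  by rewrite e3 -scalemxAl mul1mx scalerA mulrNN t1 scale1r.
have m1 : (1 < `|t|)%N by move: t0 t1; nia.
have : 2 = 0 :> 'Z_(`|t|).
  apply: mod_trace_two; rewrite -/t.
  by case: (intP t) m1 => // k m1; rewrite ?mulrNz -?pmulrn ?pchar_Zp ?oppr0.
move/(congr1 (fun z : 'Z_(`|t|) => nat_of_ord z)); rewrite (val_Zp_nat m1 2) /= => h.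
have t2 : (`|t| <= 2)%N by apply: dvdn_leq => //; rewrite /dvdn h.
by nia.
Qed.

End SL2Automorphism.

(** * The commutant of the transvections *)

Section Commutant.
Variables (n : nat) (i0 : 'I_n).
Local Notation J := (Jmx n).
Local Notation JQ := (JQ n).
Implicit Types (i j : 'I_n) (u v : 'cV[int]_(2 * n)).

(** The integral vector [v], as a rational one. *)
Definition toQ v : 'cV[rat]_(2 * n) := map_mx intr v.
Local Notation "v %:V" := (toQ v) (at level 2, format "v %:V").

(** The rational transvection along [v], minus the identity. *)
Definition tensQ v : 'M[rat]_(2 * n) := tens JQ v%:V v%:V.

Lemma omegaQ u v : omega JQ u%:V v%:V = (omega J u v)%:~R.
Proof. by rewrite /omega /toQ map_trmx -!map_mxM mxE. Qed.

Lemma tensQE v : tensQ v = map_mx intr (tens J v v).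
Proof. by rewrite /tensQ /tens !map_mxM -map_trmx. Qed.

Lemma toQM (A : 'M[int]_(2 * n)) v : (A *m v)%:V = map_mx intr A *m v%:V.
Proof. exact: map_mxM. Qed.

Lemma toQ_delta l : (delta_mx l 0)%:V = delta_mx l 0.
Proof. by rewrite /toQ map_delta_mx. Qed.

Lemma basis_ind (T : 'I_(2 * n) -> Prop) :
  (forall i, T (idx1 i)) -> (forall i, T (idx2 i)) -> forall l, T l.
Proof. by move=> h1 h2 l; case: (idxP l) => -[i ->]. Qed.

Lemma mx_basis_eq (A B : 'M[rat]_(2 * n)) :
  (forall i, A *m (ev i)%:V = B *m (ev i)%:V) ->
  (forall i, A *m (fv i)%:V = B *m (fv i)%:V) -> A = B.
Proof.
move=> he hf; have h l : col l A = col l B.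
  by rewrite !colE -!toQ_delta; move: l; apply: basis_ind => i; [exact: he | exact: hf].
by apply/matrixP => k l; have /colP/(_ k) := h l; rewrite !mxE.
Qed.

Lemma omegaQ_nondeg (y : 'cV[rat]_(2 * n)) :
  (forall i, omega JQ (ev i)%:V y = 0) -> (forall i, omega JQ (fv i)%:V y = 0) -> y = 0.
Proof.
move=> he hf; have h l : omega JQ (delta_mx l 0) y = 0.
  by move: l; apply: basis_ind => i; rewrite -toQ_delta; [exact: he | exact: hf].
have J0 : JQ *m y = 0.
  apply/colP => l; have := h l; rewrite /omega trmx_delta -mulmxA -rowE mxE => ->.
  by rewrite mxE.
by rewrite -(mulKmx (JQ_unit n) y) J0 mulmx0.
Qed.

(** A matrix commuting with the transvections along all the [ev i], and along
    [fv j] and [ev i0 + ev j] for [j] other than [i0], is a scalar plus a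
    multiple of [tensQ (ev i0)]: these vectors are eigenvectors for one and the
    same eigenvalue. *)
Lemma commutant (s : 'M[rat]_(2 * n)) :
  (forall i, s *m tensQ (ev i) = tensQ (ev i) *m s) ->
  (forall j, j != i0 -> s *m tensQ (fv j) = tensQ (fv j) *m s) ->
  (forall j, j != i0 -> s *m tensQ (ev i0 + ev j) = tensQ (ev i0 + ev j) *m s) ->
  exists l m : rat, s = l *: 1%:M + m *: tensQ (ev i0).
Proof.
move=> he hf hc.
(* [s] has [d] as an eigenvector, for an eigenvalue read off any dual vector *)
have eig d x : omega J d x = 1 -> s *m tensQ d = tensQ d *m s ->
    exists2 l : rat, s *m d%:V = l *: d%:V &
      forall y, omega JQ d%:V (s *m y) = l * omega JQ d%:V y.
  move=> dx hd; have act y : omega JQ d%:V y *: (s *m d%:V) = omega JQ d%:V (s *m y) *: d%:V.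
    by rewrite -[RHS]tensMv mulmxA -[tens _ _ _]/(tensQ d) -hd -mulmxA tensMv -scalemxAr.
  have sd := act x%:V; rewrite omegaQ dx scale1r in sd.
  exists (omega JQ d%:V (s *m x%:V)) => // y.
  have /(congr1 (omega JQ^~ x%:V)) := act y.
  rewrite sd !omegaZl omegaQ dx !mulr1 => <-.
  by rewrite mulrC.
have ce i : exists2 l : rat, s *m (ev i)%:V = l *: (ev i)%:V &
      forall y, omega JQ (ev i)%:V (s *m y) = l * omega JQ (ev i)%:V y.
  by apply: (eig (ev i) (fv i)); [rewrite omegaE eqxx | exact: he].
have [l hl hl'] := ce i0.
have hle j : s *m (ev j)%:V = l *: (ev j)%:V /\
      forall y, omega JQ (ev j)%:V (s *m y) = l * omega JQ (ev j)%:V y.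
  have [->//|j0] := eqVneq j i0; have [k hk hk'] := ce j.
  have [|c hc1 _] := eig (ev i0 + ev j) (fv j) _ (hc j j0).
    by rewrite omegaDl !omegaE eqxx eq_sym (negPf j0).
  have cs : (ev i0 + ev j)%:V = (ev i0)%:V + (ev j)%:V by exact: map_mxD.
  move: hc1; rewrite cs mulmxDr scalerDr hl hk => hc1.
  have lc := congr1 (omega JQ (fv i0)%:V) hc1; have kc := congr1 (omega JQ (fv j)%:V) hc1.
  rewrite !omegaDr !omegaZr !omegaQ !omegaE !eqxx (eq_sym i0 j) (negPf j0) /= in lc kc.
  have -> : l = k; last by split.
  by move: lc kc; rewrite oppr0 !mulr0 !addr0 !add0r mulrNz !mulrN !mulr1 => /oppr_inj-> /oppr_inj->.
have hlf j : j != i0 -> s *m (fv j)%:V = l *: (fv j)%:V /\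
      forall y, omega JQ (fv j)%:V (s *m y) = l * omega JQ (fv j)%:V y.
  move=> j0; have [|k hk hk'] := eig (fv j) (- ev j) _ (hf j j0).
    by rewrite omegaNr omegaE eqxx opprK.
  have := (hle j).2 (fv j)%:V; rewrite hk omegaZr omegaQ omegaE eqxx !mulr1 => kl.
  by rewrite kl in hk' *; split.
pose y := s *m (fv i0)%:V - l *: (fv i0)%:V.
pose m := - omega JQ (fv i0)%:V y.
have y0 : y - m *: (ev i0)%:V = 0.
  apply: omegaQ_nondeg => j.
    rewrite omegaDr omegaNr omegaZr omegaQ omegaE mulr0 subr0 /y.
    by rewrite omegaDr omegaNr omegaZr (hle j).2 subrr.
  rewrite omegaDr omegaNr omegaZr omegaQ omegaE.
  have [->|j0] := eqVneq j i0; first by rewrite /m mulrNz mulrN1 opprK addrN.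
  rewrite oppr0 mulr0 subr0 /y.
  by rewrite omegaDr omegaNr omegaZr (hlf j j0).2 subrr.
exists l, m; apply: mx_basis_eq => j; rewrite mulmxDl -!scalemxAl mul1mx tensMv omegaQ omegaE.
  by rewrite scale0r scaler0 addr0 (hle j).1.
rewrite eq_sym; have [->|j0] := eqVneq j i0.
  by move/eqP: y0; rewrite /y subr_eq0 subr_eq scale1r addrC => /eqP.
by rewrite scale0r scaler0 addr0 (hlf j j0).1.
Qed.

End Commutant.

(** * Representations that are standard on a generating set *)

Lemma mx_conj_swap (R : comNzRingType) m (A B T T' : 'M[R]_m) :
  A *m B = 1%:M -> B *m A = 1%:M -> A *m T = T' *m A -> B *m T' = T *m B.
Proof.
move=> AB BA e; transitivity (B *m (T' *m A) *m B).
  by rewrite -!mulmxA AB mulmx1.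
by rewrite -e mulmxA BA mul1mx.
Qed.

Section Recognition.
Variables (n : nat) (i0 : 'I_n) (Psi : Sp n -> 'M[rat]_(2 * n)).
Local Notation J := (Jmx n).
Local Notation JQ := (JQ n).
Local Notation "v %:V" := (toQ v) (at level 2, format "v %:V").
Implicit Types (g h : Sp n) (i j : 'I_n) (u v : 'cV[int]_(2 * n)).

(** The standard representation. *)
Definition std g : 'M[rat]_(2 * n) := map_mx intr (val g).

Hypotheses (PsiM : forall g h, Psi (g * h)%g = Psi g *m Psi h)
  (Psi1 : Psi 1%g = 1%:M)
  (Psi_iso : forall g, (Psi g)^T *m JQ *m Psi g = JQ).

(** The vectors [ev i], [fv i] and [ev i0 + ev j]. Joining those of which the
    pairing is not zero makes them the vertices of a tree. *)
Definition is_node v := [\/ exists i, v = ev i, exists i, v = fv i |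
  exists2 j, j != i0 & v = ev i0 + ev j].

Hypothesis Nil_node : forall v, is_node v -> Nil Psi v = tensQ v.

Lemma stdM g h : std (g * h)%g = std g *m std h.
Proof. by rewrite /std val_SpM map_mxM. Qed.

Lemma std_iso g : (std g)^T *m JQ *m std g = JQ.
Proof. by rewrite /std map_trmx -!map_mxM Sp_isometry. Qed.

Lemma node_e i : is_node (ev i). Proof. by constructor 1; exists i. Qed.
Lemma node_f i : is_node (fv i). Proof. by constructor 2; exists i. Qed.
Lemma node_c j : j != i0 -> is_node (ev i0 + ev j).
Proof. by move=> h; constructor 3; exists j. Qed.

(** Short-root elements carry hyperbolic pairs to pairs of nodes. *)
Lemma xv_node j k : j != k ->
  val (xv (ev k) (- fv j)) *m ev j = ev k + ev j /\
  val (xv (ev k) (- fv j)) *m fv j = fv j.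
Proof.
move=> jk; have kj : (k == j) = false by rewrite eq_sym (negPf jk).
split; rewrite mul_xv ?omegaNr ?omegaNl ?omegaE ?kj ?oppr0 // ?eqxx.
  by rewrite opprK scale1r scale0r addr0 addrC.
by rewrite ?oppr0 !scale0r !addr0.
Qed.

Section Orbit.
Variable K : Sp n -> Prop.
Hypotheses (K1 : K 1%g) (KM : forall g h, K g -> K h -> K (g * h)%g)
  (KV : forall g, K g -> K g^-1%g) (Knode : forall v, is_node v -> K (tv v)).

Lemma reach_node g v : is_node v -> reach i0 K (val g *m v).
Proof.
have r h t i : reach i0 K (val h *m bv t i).
  by apply: reach_orbit => // [k|k|k hk]; apply: Knode;
    [exact: node_e | exact: node_f | exact: node_c].
case=> [[i ->]|[i ->]|[j j0 ->]].
- exact: (r g false i).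
- exact: (r g true i).
rewrite -(xv_node j0).1 mulmxA -val_SpM; exact: (r _ false j).
Qed.
End Orbit.

Lemma reach_any v : is_node v -> exists h, val h *m ev i0 = v.
Proof.
move=> nv; have [||||h _] := @reach_node (fun=> True) _ _ _ _ 1%g v nv; rewrite //.
by rewrite val_Sp1 mul1mx; exists h.
Qed.

Lemma Psi_comm g h : (g * h = h * g)%g -> Psi g *m Psi h = Psi h *m Psi g.
Proof. by rewrite -!PsiM => ->. Qed.

Lemma Psi_sq v : Psi (tv v) *m Psi (tv v) = 1%:M + 2 *: Nil Psi v.
Proof. by rewrite /Nil scalerA mulfV ?pnatr_eq0 // scale1r addrC subrK. Qed.

Lemma node_comm g v :
  Psi g *m Psi (tv v) = Psi (tv v) *m Psi g -> is_node v ->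
  Psi g *m tensQ v = tensQ v *m Psi g.
Proof.
move=> h nv; rewrite -Nil_node // /Nil -scalemxAl -scalemxAr; congr (_ *: _).
by rewrite mulmxBr mulmxBl mulmx1 mul1mx mulmxA h -mulmxA h mulmxA.
Qed.

Lemma tensQ_ee : tensQ (ev i0) *m tensQ (ev i0) = 0.
Proof. exact: tens_id2 (JQT n) _. Qed.

Lemma tensQ_ef : tensQ (ev i0) *m (fv i0)%:V = (ev i0)%:V.
Proof. by rewrite tensMv omegaQ omegaE eqxx scale1r. Qed.

(** Up to sign, [Psi] is standard on the first transvection [t]: the matrix
    [Psi t] commutes with the transvections orthogonal to it, which leaves
    [l + m * tensQ (ev i0)], and its square is known. *)
Lemma Psi_tv0 : exists2 l : rat, l * l = 1 &
  Psi (tv (ev i0)) = l *: (1%:M + tensQ (ev i0)).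
Proof.
have comm d : omega J (ev i0) d = 0 -> is_node d ->
    Psi (tv (ev i0)) *m tensQ d = tensQ d *m Psi (tv (ev i0)).
  by move=> h nd; apply: (node_comm _ nd); apply/Psi_comm/tv_comm.
have [i|j j0|j j0|l [m e]] := @commutant n i0 (Psi (tv (ev i0))).
- by apply: comm (node_e _); rewrite omegaE.
- by apply: comm (node_f _); rewrite omegaE eq_sym (negPf j0).
- by apply: comm (node_c j0); rewrite omegaDr !omegaE addr0.
have := Psi_sq (ev i0); rewrite (Nil_node (node_e _)) e.
rewrite mulmxDr !mulmxDl -!scalemxAl -!scalemxAr !mul1mx mulmx1 tensQ_ee !scaler0 addr0.
move=> /(congr1 (mulmx^~ (fv i0)%:V)).
rewrite !mulmxDl -!scalemxAl !mul1mx tensQ_ef !scalerA => h.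
have he := congr1 (omega JQ (fv i0)%:V) h; have hf := congr1 (omega JQ (ev i0)%:V) h.
rewrite !omegaDr !omegaZr !omegaQ !omegaE eqxx /= in he hf.
have l2 : l * l = 1 by move: hf; rewrite !mulr0 !mulr1 !addr0.
exists l => //; rewrite scalerDr; congr (_ + _ *: _).
have lm : l * m = 1 by move: he; rewrite mulrNz mulr0z mulr1z; lra.
by rewrite -[LHS]mul1r -l2 -mulrA lm mulr1.
Qed.

(** The elements [h] with [Psi h = std h] up to sign form a group [K] that
    contains the transvections along the nodes, hence is transitive enough for
    [Nil Psi] to be standard on the images of the nodes under any [g]. So
    [std g ^-1 * Psi g] commutes with these transvections and is a scalar. *)
Lemma Psi_std g : Psi g = std g \/ Psi g = - std g.
Proof.
have [l l2 hl] := Psi_tv0.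
have PsiV h : Psi h *m Psi h^-1%g = 1%:M by rewrite -PsiM mulgV.
have PsiVl h : Psi h^-1%g *m Psi h = 1%:M by rewrite -PsiM mulVg.
have stdV h : std h *m std h^-1%g = 1%:M by rewrite -stdM mulgV /std val_Sp1 map_mx1.
have stdVl h : std h^-1%g *m std h = 1%:M by rewrite -stdM mulVg /std val_Sp1 map_mx1.
have lpm : l = 1 \/ l = -1.
  by have /eqP := l2; rewrite -expr2 sqrf_eq1 => /orP[]/eqP; [left | right].
have Psi_tv h : Psi (tv (val h *m ev i0)) = l *: (1%:M + Nil Psi (val h *m ev i0)).
  rewrite (Nil_act PsiM Psi1) -tv_conj !PsiM hl (Nil_node (node_e _)).
  rewrite -scalemxAr -scalemxAl; congr (_ *: _).
  by rewrite mulmxDr mulmx1 mulmxDl PsiV.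
pose K h := Psi h = std h \/ Psi h = - std h.
have Knode v : is_node v -> K (tv v).
  move=> nv; have [h hv] := reach_any nv.
  have vE : std (tv v) = 1%:M + tensQ v by rewrite /std val_tv map_mxD map_mx1 tensQE.
  have e : Psi (tv v) = l *: std (tv v) by rewrite -hv Psi_tv hv Nil_node // vE.
  rewrite /K e; case: lpm => ->; rewrite ?scale1r ?scaleN1r; by [left | right].
have K1 : K 1%g by left; rewrite Psi1 /std val_Sp1 map_mx1.
have KM g1 h1 : K g1 -> K h1 -> K (g1 * h1)%g.
  rewrite /K PsiM stdM => -[]-> []->; rewrite ?mulmxN ?mulNmx ?opprK; by [left | right].
have KV g1 : K g1 -> K g1^-1%g.
  have inv (A : 'M[rat]_(2 * n)) : A *m std g1 = 1%:M -> A = std g1^-1%g.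
    by move=> hA; rewrite -[LHS]mulmx1 -(stdV g1) mulmxA hA mul1mx.
  rewrite /K => -[] e; have := PsiVl g1; rewrite e; first by left; apply: inv.
  by rewrite mulmxN -mulNmx => /inv; right; rewrite -[LHS]opprK; congr (- _).
have NilK h : K h -> Nil Psi (val h *m ev i0) = tensQ (val h *m ev i0).
  move=> Kh; rewrite (Nil_act PsiM Psi1) (Nil_node (node_e _)).
  have -> : tensQ (val h *m ev i0) = std h *m tensQ (ev i0) *m std h^-1%g.
    rewrite /tensQ toQM (isometry_tens _ _ (std_iso h)) -mulmxA stdV mulmx1.
    by [].
  have absurd (A : 'M[rat]_(2 * n)) : 1%:M = - 1%:M :> 'M[rat]_(2 * n) -> A = 0.
    move=> /eqP; rewrite -subr_eq0 opprK -mulr2n -scaler_nat scalemx_eq0 pnatr_eq0.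
    by move=> /eqP h1; rewrite -[LHS]mulmx1 h1 mulmx0.
  have := KV _ Kh; case: Kh => e [] e'; rewrite e e' ?mulNmx ?mulmxN ?opprK //.
    have /esym/absurd z : - 1%:M = 1%:M :> 'M[rat]_(2 * n).
      by have := PsiV h; rewrite e e' mulmxN stdV.
    by rewrite [LHS]z [RHS]z.
  have /esym/absurd z : - 1%:M = 1%:M :> 'M[rat]_(2 * n).
    by have := PsiV h; rewrite e e' mulNmx stdV.
  by rewrite [LHS]z [RHS]z.
have NilG v : is_node v -> Nil Psi (val g *m v) = tensQ (val g *m v).
  by move=> nv; have [h Kh <-] := reach_node K1 KM KV Knode g nv; apply: NilK.
pose s := std g^-1%g *m Psi g.
have sc v : is_node v -> s *m tensQ v = tensQ v *m s.
  move=> nv; have := NilG v nv; rewrite (Nil_act PsiM Psi1) Nil_node // => e.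
  have e1 : Psi g *m tensQ v = tensQ (val g *m v) *m Psi g.
    by rewrite -e -(mulmxA _ _ (Psi g)) PsiVl mulmx1.
  have e2 : std g^-1%g *m tensQ (val g *m v) = tensQ v *m std g^-1%g.
    apply: (mx_conj_swap (stdV g) (stdVl g)).
    by rewrite /tensQ toQM; apply: isometry_tens (std_iso g).
  by rewrite /s -mulmxA e1 mulmxA e2 mulmxA.
have [i|j j0|j j0|k [m e]] := @commutant n i0 s.
- exact: sc (node_e _).
- exact: sc (node_f _).
- exact: sc (node_c j0).
have m0 : m = 0.
  have := sc _ (node_f i0); rewrite e mulmxDl mulmxDr -!scalemxAl -!scalemxAr.
  rewrite mul1mx mulmx1 => /addrI/eqP.
  rewrite -subr_eq0 -scalerBr scalemx_eq0 subr_eq0 => /orP[/eqP //|].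
  by rewrite (negPf (tens_comm_omega (JQT n) _)) // omegaQ omegaE eqxx oner_neq0.
have gk : Psi g = k *: std g.
  have -> : Psi g = std g *m s by rewrite /s mulmxA stdV mul1mx.
  by rewrite e m0 scale0r addr0 -scalemxAr mulmx1.
have k2 : k * k = 1.
  have e2 : (k *: std g)^T *m JQ *m (k *: std g) = (k * k) *: JQ.
    rewrite -[in RHS](std_iso g) -scalemxAr.
    have -> : (k *: std g)^T = k *: (std g)^T by rewrite linearZ.
    by rewrite -!scalemxAl scalerA.
  have := Psi_iso g; rewrite gk e2 => /matrixP/(_ (idx1 i0) (idx2 i0)).
  by rewrite !mxE pair12 pair2x eqxx subr0 mulr1.
have /eqP := k2; rewrite gk -expr2 sqrf_eq1 => /orP[]/eqP->;
  rewrite ?scale1r ?scaleN1r; by [left | right].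
Qed.

End Recognition.

(** * Rigidity of faithful symplectic representations *)

Section Frame.
Variables (n : nat) (i0 : 'I_n) (Phi : Sp n -> 'M[rat]_(2 * n)).
Local Notation J := (Jmx n).
Local Notation JQ := (JQ n).
Local Notation om := (omega J).
Local Notation omQ := (omega JQ).
Local Notation NilP := (Nil Phi).
Local Notation "v %:V" := (toQ v) (at level 2, format "v %:V").
Implicit Types (g h : Sp n) (i j : 'I_n) (u v : 'cV[int]_(2 * n))
  (x y z : 'cV[rat]_(2 * n)).

Hypotheses (PhiM : forall g h, Phi (g * h)%g = Phi g *m Phi h)
  (Phi1 : Phi 1%g = 1%:M) (Phi_inj : injective Phi)
  (Phi_iso : forall g, (Phi g)^T *m JQ *m Phi g = JQ).
Hypothesis tc : forall i, trace_cond Phi i.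

Let JT := JQT n.

Lemma Nil_node_tens v : is_node i0 v ->
  exists (k : rat) x, [/\ k != 0, x != 0 & NilP v = k *: tens JQ x x].
Proof.
move=> nv; have [h <-] := reach_any nv.
have [k [x [k0 x0 e]]] := Nil_tens PhiM Phi1 Phi_inj Phi_iso (tc i0).
exists k, (Phi h *m x); split=> //.
  by apply: contraNneq x0 => hx; rewrite -[x]mul1mx -(PhiV PhiM Phi1 h) -mulmxA hx mulmx0.
rewrite (Nil_act PhiM Phi1) e -scalemxAr -scalemxAl (isometry_tens _ _ (Phi_iso h)).
by rewrite -(mulmxA _ (Phi h)) (PhiMV PhiM Phi1) mulmx1.
Qed.

(** [frame k v x]: the vector [x] represents [v], with scaling factor [k]. *)
Definition frame (k : rat) v x := NilP v = k *: tens JQ x x.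

Lemma frame_orth k l u v x y : k != 0 -> l != 0 -> frame k u x -> frame l v y ->
  om u v = 0 -> omQ x y = 0.
Proof.
move=> k0 l0 hu hv /(Nil_comm PhiM); rewrite hu hv => e.
apply/eqP; apply: contraT => /(tens_comm_omega JT)/eqP; case.
move: e; rewrite -!scalemxAl -!scalemxAr !scalerA (mulrC l k) => /(congr1 (GRing.scale (k * l)^-1)).
by rewrite !scalerA mulVf ?mulf_neq0 // !scale1r.
Qed.

(** The representing vector of a neighbour can be taken with the same factor
    and with the pairing of the standard representation. *)
Lemma frame_next k u v x : k != 0 -> frame k u x -> is_node i0 v ->
  \tr (NilP u *m NilP v) = -1 -> exists2 y, frame k v y & k * omQ x y = 1.
Proof.
move=> k0 hu nv; have [l [y [l0 y0 hv]]] := Nil_node_tens nv.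
rewrite hu hv -scalemxAl -scalemxAr scalerA tensM scalerA linearZ /= mxtrace_tens.
rewrite (omegaC JT y x) mulrN => /oppr_inj => e; set w := omQ x y in e *.
have w0 : w != 0 by apply: contra_eq_neq e => ->; rewrite !mulr0 eq_sym oner_neq0.
exists ((k * w)^-1 *: y); last by rewrite omegaZr -/w; field; rewrite k0 w0.
rewrite /frame hv tensZl tensZr !scalerA; congr (_ *: _).
apply: (mulIf (mulf_neq0 (mulf_neq0 k0 w0) w0)).
have -> : l * (k * w * w) = 1 by rewrite -[RHS]e; ring.
by field; rewrite k0 w0.
Qed.

Lemma frameN k v x : frame k v x -> frame k v (- x).
Proof. by rewrite /frame tensNl tensNr opprK. Qed.

Lemma Nil_tr_act g u v :
  \tr (NilP (val g *m u) *m NilP (val g *m v)) = \tr (NilP u *m NilP v).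
Proof.
rewrite !(Nil_act PhiM Phi1).
have -> : Phi g *m NilP u *m Phi g^-1%g *m (Phi g *m NilP v *m Phi g^-1%g) =
    Phi g *m (NilP u *m (Phi g^-1%g *m Phi g) *m NilP v) *m Phi g^-1%g.
  by rewrite !mulmxA.
rewrite (PhiV PhiM Phi1 g) mulmx1 mxtrace_mulC.
by rewrite (mulmxA _ (Phi g)) (PhiV PhiM Phi1 g) mul1mx.
Qed.

Lemma tr_ef i : \tr (NilP (ev i) *m NilP (fv i)) = -1.
Proof. by have [_ _] := Nil_pair PhiM Phi1 Phi_inj Phi_iso (tc i). Qed.

Lemma tr_cf j : j != i0 -> \tr (NilP (ev i0 + ev j) *m NilP (fv j)) = -1.
Proof.
move=> /xv_node[e1 e2]; have := Nil_tr_act (xv (ev i0) (- fv j)) (ev j) (fv j).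
by rewrite e1 e2 tr_ef.
Qed.

Lemma tr_cf0 j : j != i0 -> \tr (NilP (ev i0 + ev j) *m NilP (fv i0)) = -1.
Proof.
rewrite eq_sym => /xv_node[e1 e2].
have := Nil_tr_act (xv (ev j) (- fv i0)) (ev i0) (fv i0).
by rewrite e1 e2 tr_ef addrC.
Qed.

(** A coherent choice of representing vectors for all nodes. There is no
    obstruction because each choice is made along an edge of the tree
    [ev i0 - fv i0 - (ev i0 + ev j) - fv j - ev j]. *)
Lemma frame_exists : exists (k : rat) (ze zf zc : 'I_n -> 'cV[rat]_(2 * n)), k != 0 /\
  forall j, [/\ frame k (ev j) (ze j), frame k (fv j) (zf j), k * omQ (ze j) (zf j) = 1 &
    j != i0 -> [/\ frame k (ev i0 + ev j) (zc j), k * omQ (zc j) (zf i0) = 1 &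
      k * omQ (zc j) (zf j) = 1]].
Proof.
have [k [e0 [k0 _ he0]]] := Nil_node_tens (node_e i0 i0).
have [f0 hf0 ef0] := frame_next k0 he0 (node_f i0 i0) (tr_ef i0).
have H j : exists t : 'cV[rat]_(2 * n) * 'cV[rat]_(2 * n) * 'cV[rat]_(2 * n),
    [/\ frame k (ev j) t.1.1, frame k (fv j) t.1.2, k * omQ t.1.1 t.1.2 = 1 &
    if j == i0 then t.1.2 = f0 else [/\ frame k (ev i0 + ev j) t.2,
      k * omQ t.2 f0 = 1 & k * omQ t.2 t.1.2 = 1]].
  have [->|j0] := eqVneq j i0; first by exists (e0, f0, 0).
  have nc := node_c j0.
  have [c hc ec] : exists2 c, frame k (ev i0 + ev j) c & k * omQ c f0 = 1.
    have [|c hc ec] := frame_next k0 hf0 nc; first by rewrite mxtrace_mulC tr_cf0.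
    exists (- c); first exact: frameN.
    by rewrite omegaNl (omegaC JT c) opprK.
  have [f hf ecf] := frame_next k0 hc (node_f i0 j) (tr_cf j0).
  have [|e he eef] := frame_next k0 hf (node_e i0 j).
    by rewrite mxtrace_mulC tr_ef.
  exists (- e, f, c); split=> //=; first exact: frameN.
  by rewrite omegaNl (omegaC JT e) opprK.
have [t ht] := fin_all_exists H.
exists k, (fun j => (t j).1.1), (fun j => (t j).1.2), (fun j => (t j).2); split=> // j.
have f0E : (t i0).1.2 = f0 by have [_ _ _] := ht i0; rewrite eqxx.
by have [h1 h2 h3] := ht j; case: eqP => // _ [h4 h5 h6]; split=> // _; rewrite f0E.
Qed.

(** Up to signs, [Phi] is conjugate to the standard representation. *)
Theorem rigidity : exists2 P : 'M[rat]_(2 * n), P \in unitmx &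
  forall g, Phi g = P *m std g *m invmx P \/ Phi g = - (P *m std g *m invmx P).
Proof.
have [k [ze [zf [zc [k0 H]]]]] := frame_exists.
pose zz l := if odd (val l) then zf (plane l) else ze (plane l).
have o1 i : odd (val (idx1 i)) = false by rewrite /= oddM.
have o2 i : odd (val (idx2 i)) = true by rewrite /= oddD oddM.
have zz1 i : zz (idx1 i) = ze i by rewrite /zz plane1 o1.
have zz2 i : zz (idx2 i) = zf i by rewrite /zz plane2 o2.
pose P : 'M[rat]_(2 * n) := \matrix_(r, l) zz l r 0.
have Pd l : P *m (delta_mx l 0) = zz l by rewrite -colE; apply/colP => r; rewrite !mxE.
have Pe i : P *m (ev i)%:V = ze i by rewrite toQ_delta Pd zz1.
have Pf i : P *m (fv i)%:V = zf i by rewrite toQ_delta Pd zz2.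
have he j : frame k (ev j) (ze j) by case: (H j).
have hf j : frame k (fv j) (zf j) by case: (H j).
have ef i j : k * omQ (ze i) (zf j) = (i == j)%:R.
  have [<-|ij] := eqVneq; first by case: (H i).
  by rewrite (frame_orth k0 k0 (he i) (hf j)) ?mulr0 // omegaE (negPf ij).
have fe i j : k * omQ (zf i) (ze j) = - (i == j)%:R.
  by rewrite (omegaC JT) mulrN ef eq_sym.
have ee i j : k * omQ (ze i) (ze j) = 0.
  by rewrite (frame_orth k0 k0 (he i) (he j)) ?mulr0 // omegaE.
have ff i j : k * omQ (zf i) (zf j) = 0.
  by rewrite (frame_orth k0 k0 (hf i) (hf j)) ?mulr0 // omegaE.
(* the chosen vectors form a symplectic basis up to the factor [k] *)
have G : k *: (P^T *m JQ *m P) = JQ.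
  apply/matrixP => l r; rewrite mxE.
  have -> : (P^T *m JQ *m P) l r = omQ (zz l) (zz r).
    rewrite -!Pd /omega trmx_mul trmx_delta -!mulmxA -rowE.
    by rewrite !mulmxA -colE !mxE.
  have -> : JQ l r = (om (delta_mx l 0) (delta_mx r 0))%:~R by rewrite omega_delta mxE.
  case: (idxP l) (idxP r) => -[i ->] [] [j ->]; rewrite ?zz1 ?zz2.
  - by rewrite ee omega_ee.
  - by rewrite ef omega_ef; case: eqP.
  - by rewrite fe omega_fe; case: eqP.
  by rewrite ff omega_ff.
have Pu : P \in unitmx.
  have : k *: (P^T *m JQ *m P) \in unitmx by rewrite G JQ_unit.
  by rewrite scalemxAr unitmx_mul => /andP[_]; rewrite unitmxZ ?unitfE.
have Gom x y : k * omQ (P *m x) (P *m y) = omQ x y.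
  by rewrite /omega -[in RHS]G trmx_mul -!mulmxA -scalemxAl -scalemxAr !mxE !mulmxA.
(* the extra nodes have the expected representing vectors *)
have Pc j : j != i0 -> zc j = P *m (ev i0 + ev j)%:V.
  move=> j0; have [_ _ _ /(_ j0)[hc c0 cj]] := H j.
  have i0j : i0 != j by rewrite eq_sym.
  rewrite -[LHS](mulKVmx Pu); congr (_ *m _); apply/eqP; rewrite -subr_eq0; apply/eqP.
  apply: omegaQ_nondeg => i; rewrite omegaDr omegaNr omegaQ -Gom mulKVmx //.
    rewrite Pe omegaDr !omegaE addr0.
    by rewrite (frame_orth k0 k0 (he i) hc) ?mulr0 // omegaDr !omegaE addr0.
  rewrite Pf omegaDr !omegaE (omegaC JT) mulrN.
  have [->|ii0] := eqVneq i i0.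
    by rewrite c0 (negPf i0j) oppr0 addr0 mulrNz opprK addNr.
  have [->|ij] := eqVneq i j.
    by rewrite cj oppr0 add0r mulrNz opprK addNr.
  rewrite (frame_orth k0 k0 hc (hf i)) ?mulr0 ?oppr0 ?addr0 ?subrr //.
  by rewrite omegaDl !omegaE eq_sym (negPf ii0) eq_sym (negPf ij) addr0.
have Pn v : is_node i0 v -> frame k v (P *m v%:V).
  case=> [[i ->]|[i ->]|[j j0 ->]]; rewrite ?Pe ?Pf -?Pc //.
  by have [_ _ _ /(_ j0)[]] := H j.
have ktP x : k *: tens JQ (P *m x) (P *m x) = P *m tens JQ x x *m invmx P.
  have e : k *: (P^T *m JQ) = JQ *m invmx P.
    by rewrite -[in RHS]G -scalemxAl -(mulmxA _ P) mulmxV // mulmx1.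
  by rewrite /tens trmx_mul -!mulmxA -e -!scalemxAr !mulmxA.
pose Psi g := invmx P *m Phi g *m P.
have PsiM g h : Psi (g * h)%g = Psi g *m Psi h.
  by rewrite /Psi PhiM !mulmxA mulmxK.
have Psi1 : Psi 1%g = 1%:M by rewrite /Psi Phi1 mulmx1 mulVmx.
have Psi_iso g : (Psi g)^T *m JQ *m Psi g = JQ.
  rewrite -{1}G -scalemxAr -scalemxAl.
  have key (A : 'M[rat]_(2 * n)) : A^T *m (P^T *m JQ *m P) *m A =
      (P *m A)^T *m JQ *m (P *m A) by rewrite trmx_mul !mulmxA.
  have PPsi : P *m Psi g = Phi g *m P by rewrite /Psi !mulmxA mulmxV // mul1mx.
  rewrite key PPsi; have -> : (Phi g *m P)^T *m JQ *m (Phi g *m P) =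
      P^T *m ((Phi g)^T *m JQ *m Phi g) *m P by rewrite trmx_mul !mulmxA.
  by rewrite Phi_iso.
have NilPsi v : is_node i0 v -> Nil Psi v = tensQ v.
  move=> nv; have PsiT : Psi (tv v) *m Psi (tv v) = invmx P *m (Phi (tv v) *m Phi (tv v)) *m P.
    by rewrite /Psi !mulmxA mulmxK.
  have -> : Nil Psi v = invmx P *m NilP v *m P.
    by rewrite /Nil PsiT -scalemxAr -scalemxAl mulmxBr mulmxBl mulmx1 mulVmx.
  by rewrite (Pn v nv) ktP !mulmxA mulVmx // mul1mx mulmxKV.
exists P => // g.
have [e|e] := Psi_std PsiM Psi1 Psi_iso NilPsi g; [left | right].
  by rewrite -e /Psi !mulmxA mulmxV // mul1mx mulmxK.
by rewrite -mulNmx -mulmxN -e /Psi !mulmxA mulmxV // mul1mx mulmxK.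
Qed.

End Frame.

(** * Infinitely many twisted conjugacy classes *)

Section Invariant.
Variables (n : nat) (phi : {multiplicative Sp n -> Sp n}) (P : 'M[rat]_(2 * n)).
Hypotheses (Pu : P \in unitmx)
  (phiP : forall g, std (phi g) = P *m std g *m invmx P \/
                    std (phi g) = - (P *m std g *m invmx P)).
Implicit Types (g x y : Sp n) (i : 'I_n).

Definition twisted_trace x : rat := \tr (std x *m P) ^+ 2.

(** When [phi] is conjugation by [P] up to sign, the twisted classes become
    conjugacy classes, up to sign, after multiplication by [P]. *)
Lemma twisted_trace_invariant x y :
  reidemeister_class phi x = reidemeister_class phi y ->
  twisted_trace x = twisted_trace y.
Proof.
move=> e; have : reidemeister_class phi y y.
  by exists 1%g; rewrite invg1 multiplicative1 mul1g mulg1.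
rewrite -e => -[g ->]; rewrite /twisted_trace !stdM.
have key : \tr (std g *m std x *m (P *m std g^-1%g *m invmx P) *m P) = \tr (std x *m P).
  have -> : std g *m std x *m (P *m std g^-1%g *m invmx P) *m P =
      std g *m (std x *m P *m std g^-1%g) by rewrite !mulmxA mulmxKV.
  by rewrite mxtrace_mulC -!mulmxA -stdM mulVg /std val_Sp1 map_mx1 mulmx1.
by case: (phiP g^-1%g) => ->; rewrite ?mulmxN ?mulNmx ?raddfN /= ?sqrrN key.
Qed.

Lemma std_tvX (v : 'cV[int]_(2 * n)) k : std (tv v ^+ k)%g = 1%:M + k%:R *: tensQ v.
Proof.
by rewrite /std val_tvX map_mxD map_mx1 tensQE -scaler_nat map_mxZ /= natz.
Qed.

(** The trace varies along the powers of some transvection. *)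
Lemma twisted_slope i : exists y, \tr (std y *m tensQ (ev i) *m P) != 0.
Proof.
have tr y : \tr (std y *m tensQ (ev i) *m P) =
    omega (JQ n) (toQ (ev i)) (P *m toQ (val y *m ev i)).
  by rewrite mxtrace_mulC mulmxA mul_tens mxtrace_tens toQM mulmxA.
apply: contrapT => h.
have z d : is_node i d -> omega (JQ n) (toQ (ev i)) (P *m toQ d) = 0.
  move=> /reach_any[y <-]; rewrite -tr; apply/eqP; apply: contraT => hy.
  by case: h; exists y.
have r0 : (toQ (ev i))^T *m JQ n *m P = 0.
  apply/rowP => l; rewrite [RHS]mxE.
  have -> : ((toQ (ev i))^T *m JQ n *m P) 0 l =
      omega (JQ n) (toQ (ev i)) (P *m toQ (delta_mx l 0)).
    by rewrite /omega toQ_delta !mulmxA -colE [RHS]mxE.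
  by move: l; apply: basis_ind => k; apply: z; [exact: node_e | exact: node_f].
have := omegaQ (ev i) (fv i); rewrite omegaE eqxx /omega.
rewrite -[toQ (fv i)](mulKVmx Pu) (mulmxA _ P) r0 mul0mx mxE => /eqP.
by rewrite eq_sym oner_eq0.
Qed.

Lemma reidemeister_infinite i : ~ finite_set (reidemeister_classes phi).
Proof.
have [y hy] := twisted_slope i; set b := \tr _ in hy; pose a := \tr (std y *m P).
pose x k := (y * tv (ev i) ^+ k)%g.
have tx k : twisted_trace (x k) = (a + k%:R * b) ^+ 2.
  rewrite /twisted_trace stdM std_tvX mulmxDr mulmx1 mulmxDl raddfD /=.
  by rewrite -scalemxAr -scalemxAl linearZ.
(* from the rank [N] on, the terms [a + k * b] have the sign of [b] *)
have [N hN] : exists N : nat, `|a| < N%:R * `|b|.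
  have b0 : 0 < `|b| by rewrite normr_gt0.
  exists (Num.bound (`|a| / `|b|)); rewrite -ltr_pdivrMr //.
  by apply: archi_boundP; rewrite divr_ge0.
pose F k := reidemeister_class phi (x (N + k)%N).
have Finj : injective F.
  move=> k l /twisted_trace_invariant; rewrite !tx => /eqP.
  rewrite -subr_eq0 subr_sqr mulf_eq0 => /orP[/eqP e|/eqP e].
    have : (k%:R - l%:R) * b = 0 by rewrite -[RHS]e !natrD; ring.
    move/eqP; rewrite mulf_eq0 (negPf hy) orbF subr_eq0 eqr_nat.
    by move=> /eqP.
  have e2 : a * 2 = - ((N + k + (N + l))%:R * b).
    apply/eqP; rewrite -subr_eq0 opprK; apply/eqP; rewrite -[RHS]e !natrD; ring.
  have := congr1 Num.norm e2; rewrite normrN !normrM !normr_nat => e3.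
  have : `|a| * 2 < `|a| * 2; last by rewrite ltxx.
  rewrite {2}e3; apply: (lt_le_trans (_ : _ < N%:R * `|b| * 2)).
    by rewrite ltr_pM2r.
  rewrite mulrAC ler_wpM2r // -natrM ler_nat; lia.
move=> fin; apply: infinite_nat.
have FT : finite_set (range F).
  apply: sub_finite_set fin => C [k _ <-]; exists (x (N + k)%N) => //.
by rewrite -(eq_finite_set (inj_card_eq (f := F) _)) // => k l _ _; apply: Finj.
Qed.

End Invariant.

(** Every automorphism of Sp(2n, Z) is, up to signs, the conjugation by an
    invertible rational matrix. *)
Lemma automorphism_rigidity n (i0 : 'I_n) (phi : {multiplicative Sp n -> Sp n}) :
  bijective phi -> exists2 P : 'M[rat]_(2 * n), P \in unitmx &
  forall g, std (phi g) = P *m std g *m invmx P \/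
            std (phi g) = - (P *m std g *m invmx P).
Proof.
move=> phi_bij; pose Phi g := std (phi g).
have PhiM g h : Phi (g * h)%g = Phi g *m Phi h by rewrite /Phi gmulfM stdM.
have Phi1 : Phi 1%g = 1%:M by rewrite /Phi multiplicative1 /std val_Sp1 map_mx1.
have Phi_inj : injective Phi.
  move=> g h; rewrite /Phi /std => e; apply: (bij_inj phi_bij); apply: val_inj.
  apply/matrixP => k l; have := congr1 (fun A : 'M[rat]_(2 * n) => A k l) e.
  by rewrite !mxE => /intr_inj.
have Phi_iso g : (Phi g)^T *m JQ n *m Phi g = JQ n by exact: std_iso.
apply: (rigidity i0 PhiM Phi1 Phi_inj Phi_iso) => i.
case: n i0 phi phi_bij @Phi PhiM Phi1 Phi_inj Phi_iso i => [|[|n]] i0 phi phi_bij Phi PhiM Phi1 Phi_inj Phi_iso i.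
- by case: i0.
- rewrite /trace_cond (ord1 i) -PhiM /Phi.
  have := trace_sq4 phi_bij; set t := \tr _ => t2.
  have CH : mx1 (phi (tv (ev ord0))) *m mx1 (phi (tv (ev ord0))) =
    t *: mx1 (phi (tv (ev ord0))) - 1%:M := mx1_CH _.
  rewrite gmulfM /std val_SpM -[val (phi _) *m _]/(mx1 _ *m mx1 _) CH.
  rewrite trace_map_mx raddfB /= linearZ /= -/t t2 mxtrace1.
  by [].
pose j : 'I_n.+2 := if i == ord0 then ord_max else ord0.
apply: (@trace_cond_gt1 _ _ PhiM Phi1 Phi_inj Phi_iso i j).
by rewrite /j; case: (i =P ord0) => [->|/eqP //].
Qed.

Theorem theorem3p3 (n : nat) (hn : (1 <= n)%N)
  (phi : {multiplicative Sp n -> Sp n}) (phi_bij : bijective phi) :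
  reidemeister_number phi = +oo%E.
Proof.
have [P Pu phiP] := automorphism_rigidity (Ordinal hn) phi_bij.
rewrite /reidemeister_number; case: pselect => // fin.
by case: (reidemeister_infinite Pu phiP (Ordinal hn) fin).
Qed.
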